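(* Let $M$ be a von Neumann algebra of type I and let $\Delta : M\to M$ be a 2-local derivation. Then $\Delta$ is a derivation.
   Context: A linear map $D:M\to M$ on a von Neumann algebra $M$ is called a derivation if $D(xy)=D(x)y+xD(y)$ for all $x,y\in M$. A map $\Delta:M\to M$ (not assumed linear) is called a 2-local derivation if for any two elements $x,y\in M$ there exists a derivation $D_{x,y}:M\to M$ such that $\Delta(x)=D_{x,y}(x)$ and $\Delta(y)=D_{x,y}(y)$. Since every derivation of a von Neumann algebra is inner, this is equivalent to: for any $x,y\in M$ there exists $a\in M$ such that $\Delta(x)=ax-xa$ and $\Delta(y)=ay-ya$. *)

(* Defs.v *)
From HB Require Import structures.
From mathcomp Require Import all_boot all_order all_algebra.
From mathcomp Require Import all_classical all_reals all_analysis.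
From mathcomp.real_closed Require Import complex.

Set Implicit Arguments.
Unset Strict Implicit.
Unset Printing Implicit Defensive.

Import Order.TTheory GRing.Theory Num.Theory.
Import numFieldNormedType.Exports.

Local Open Scope classical_set_scope.
Local Open Scope ring_scope.

Section VonNeumannAlgebras.
Context {R : realType} {H : completeNormedModType R[i]}.
Implicit Types (ip : {dot H for Num.Def.conjC}) (M : set (H -> H)) (x y p q : H -> H).

(* A complex Hilbert space is a Banach space whose norm comes from an inner
   product; forms of type [{dot H for Num.Def.conjC}] are positive definite, hermitian,
   linear in the first argument and conjugate-linear in the second. *)
Definition inner_product_norm ip : Prop :=
  forall u : H, `|u| ^+ 2 = ip u u.

(* Operators are plain functions [H -> H], with their pointwise vector space
   structure; the product of operators is composition. *)
Definition bounded_operator x : Prop :=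
  linear x /\ exists k : R[i], forall u : H, `|x u| <= k * `|u|.

Definition adjoint_of ip x y : Prop :=
  forall u v : H, ip (x u) v = ip u (y v).

Definition commutant M : set (H -> H) :=
  [set x | bounded_operator x /\ forall y, M y -> x \o y = y \o x].

(* The first condition makes [M] a subalgebra of the algebra of bounded
   operators that contains the identity. *)
Definition von_neumann_algebra ip M : Prop :=
  M = commutant (commutant M) /\
  forall x, M x -> exists2 y, M y & adjoint_of ip x y.

Definition projection ip M p : Prop :=
  [/\ M p, p \o p = p & adjoint_of ip p p].

Definition central_projection ip M p : Prop :=
  projection ip M p /\ forall x, M x -> p \o x = x \o p.

Definition abelian_projection ip M p : Prop :=
  projection ip M p /\
  forall x y, M x -> M y ->
    (p \o x \o p) \o (p \o y \o p) = (p \o y \o p) \o (p \o x \o p).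

(* For projections, [z \o p = p] says that the range of [p] is contained in the
   range of [z], i.e. that [z] majorizes [p]. *)
Definition type_I ip M : Prop :=
  forall z, central_projection ip M z -> z <> 0 ->
    exists p, [/\ abelian_projection ip M p, p <> 0 & z \o p = p].

(* The type [{fun M >-> M}] consists of functions on [H -> H] that map [M] into
   [M]; their values outside [M] are irrelevant below. *)
Definition derivation M (D : {fun M >-> M}) : Prop :=
  (forall (a : R[i]) x y, M x -> M y -> D (a *: x + y) = a *: D x + D y) /\
  (forall x y, M x -> M y -> D (x \o y) = (D x \o y) + (x \o D y)).

Definition two_local_derivation M (Delta : {fun M >-> M}) : Prop :=
  forall x y, M x -> M y ->
    exists D : {fun M >-> M}, [/\ derivation D, Delta x = D x & Delta y = D y].

End VonNeumannAlgebras.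

(* Main.v *)
From HB Require Import structures.
Require Import Defs.
From mathcomp Require Import all_boot all_order all_algebra.
From mathcomp Require Import all_classical all_reals all_analysis.
From mathcomp.real_closed Require Import complex.
From mathcomp Require Import ring lra.
From Stdlib Require Ncring Ncring_tac.
Import -(notations, coercions) Ncring Ncring_tac.

Set Implicit Arguments.
Unset Strict Implicit.
Unset Printing Implicit Defensive.

Import Order.TTheory GRing.Theory Num.Theory.
Import numFieldNormedType.Exports.

Local Open Scope classical_set_scope.
Local Open Scope ring_scope.

(** The proof transports the trace argument for matrices. There a derivation is
    a commutator with some [a], and
      tr (Delta x * y) = tr ([a, x] * y) = - tr (x * [a, y]) = - tr (x * Delta y)
    is additive in [x]; as the trace form is nondegenerate, [Delta] is additive.

    Let [p] be an abelian projection of [M]. Then [x * p * y |-> p * y * x * p]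
    plays the role of a trace, defined on the ideal [M p M] and with values in
    the commutative corner [p M p]. Derivations [D] of [M] respect it because
    [w |-> p * D w * p] is a derivation of this corner, and such a derivation
    vanishes ([corner_derivation_zero]). It follows that for [a] in [p M] and
    [b] in [M p] the values [a * D x * b] depend on [D] only through [D (b * a)]
    ([derivation_sandwich_eq0]). Taking for [D] a derivation that agrees with
    [Delta] at [b * a] one gets [a * Delta x * b = a * D x * b] for all [x] at
    once, so the left-hand side is additive in [x]. In an algebra of type I the
    abelian projections separate points ([abelian_faithful]), so [Delta] is
    additive. Agreement with derivations at the pairs [(a *: x, x)] and
    [(x * x, x)] shows that [Delta] is homogeneous and is a Jordan derivation;
    by a theorem of Bresar a Jordan derivation of a semiprime ring without
    2-torsion satisfies the Leibniz rule ([jordan_derivation_leibniz]).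

    The vanishing of derivations on the commutative corner is where operators
    enter, since continuity of the derivations is not part of their definition.
    A self-adjoint [c] can be written [(2 e - 1) s^2] with [e] a projection and
    [s] self-adjoint, both commuting with all that commutes with [c]
    ([sign_decomposition]). In the commutative corner a derivation kills the
    idempotent [e] and sends [s^2] to a multiple of [s]; hence
    [|D c u|^2 <= L |c u| |u|] for some constant [L] ([corner_growth]). The same
    applied to [c - l], which has the same image under the derivation, says
    that the image is small wherever [c] is close to [l], for each real [l]. If
    the image were nonzero, it would be bounded below on a nonzero subspace
    invariant under [c], on which [c] has an approximate eigenvalue [l]
    ([approximate_eigenvalue]): a contradiction ([corner_derivation_self]). *)

(** * Jordan derivations of semiprime rings *)

(** These two instances let [non_commutative_ring] normalize expressions in a
    ring. *)
#[local] Instance pzRing_ncops (R : pzRingType) :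
  @Ring_ops R 0 1 +%R *%R (fun x y => x - y) -%R eq := {}.

#[local] Instance pzRing_ncring (R : pzRingType) :
  Ring (Ro := pzRing_ncops R).
Proof.
split.
- exact: eq_equivalence.
- by move=> a b -> c e ->.
- by move=> a b -> c e ->.
- by move=> a b -> c e ->.
- by move=> a b ->.
- exact: add0r.
- exact: addrC.
- exact: addrA.
- exact: mul1r.
- exact: mulr1.
- exact: mulrA.
- by move=> x y z; exact: mulrDl.
- by move=> x y z; exact: mulrDr.
- by [].
- exact: subrr.
Qed.

Section JordanDerivations.
Variables (R : pzRingType) (d : R -> R).
Hypothesis torsion2 : forall x : R, x + x = 0 -> x = 0.
Hypothesis semiprime : forall x : R, (forall y, x * y * x = 0) -> x = 0.
Hypothesis dD : forall x y, d (x + y) = d x + d y.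
Hypothesis dsq : forall x, d (x * x) = d x * x + x * d x.

(** With [t = u * x * v], the hypothesis at [x * u * y], at [y] and at [x] moves
    [t * y * t] to its own opposite. *)
Lemma semiprime_anticommute (u v : R) :
  (forall x, u * x * v + v * x * u = 0) -> forall x, u * x * v = 0.
Proof.
move=> h x; apply: semiprime => y; apply: torsion2.
have -> : u * x * v * y * (u * x * v) + u * x * v * y * (u * x * v) =
    (u * x * v + v * x * u) * y * u * x * v
    - (u * (x * u * y) * v + v * (x * u * y) * u) * x * v
    + u * x * (u * y * v + v * y * u) * x * v.
  non_commutative_ring.
by rewrite !h !(mul0r, mulr0) subrr addr0.
Qed.

Lemma semiprime_mul_sym (u v : R) :
  (forall x, u * x * v = 0) -> forall x, v * x * u = 0.
Proof.
move=> h x; apply: semiprime => y.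
have -> : v * x * u * y * (v * x * u) = v * x * (u * y * v) * x * u.
  non_commutative_ring.
by rewrite h !(mul0r, mulr0).
Qed.

Lemma jordan_anticomm (x y : R) :
  d (x * y + y * x) = d x * y + x * d y + (d y * x + y * d x).
Proof.
have /eqP := dsq (x + y).
have -> : (x + y) * (x + y) = x * x + (x * y + y * x) + y * y.
  non_commutative_ring.
rewrite !dD !dsq -dD -subr_eq0 => /eqP e.
apply/eqP; rewrite -subr_eq0; apply/eqP; rewrite -[RHS]e.
non_commutative_ring.
Qed.

Lemma jordan0 : d 0 = 0.
Proof. by apply: (@addrI _ (d 0)); rewrite -dD !addr0. Qed.

Lemma jordanN (x : R) : d (- x) = - d x.
Proof. by apply/eqP; rewrite -addr_eq0 -dD addNr jordan0. Qed.

(** With [w = x * y + y * x], the element [x * w + w * x] is also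
    [x^2 y + y x^2 + 2 x y x]; expand [d] of both by [jordan_anticomm]. *)
Lemma jordan_triple (x y : R) :
  d (x * y * x) = d x * y * x + x * d y * x + x * y * d x.
Proof.
apply/eqP; rewrite -subr_eq0; apply/eqP; apply: torsion2.
have e : x * (x * y + y * x) + (x * y + y * x) * x =
    x * x * y + y * (x * x) + (x * y * x + x * y * x).
  non_commutative_ring.
have := congr1 d e.
rewrite (jordan_anticomm x (x * y + y * x)) (jordan_anticomm x y).
rewrite (dD (_ + _)) (jordan_anticomm (x * x)) dsq (dD (x * y * x)) => /eqP.
rewrite -subr_eq0 => /eqP e'.
rewrite -[RHS]oppr0 -e'; non_commutative_ring.
Qed.

Lemma jordan_triple_lin (x y z : R) :
  d (x * y * z + z * y * x) = d x * y * z + x * d y * z + x * y * d z +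
   (d z * y * x + z * d y * x + z * y * d x).
Proof.
have := jordan_triple (x + z) y.
have -> : (x + z) * y * (x + z) = x * y * x + (x * y * z + z * y * x) + z * y * z.
  non_commutative_ring.
rewrite !dD !jordan_triple -dD => /eqP; rewrite -subr_eq0 => /eqP e.
apply/eqP; rewrite -subr_eq0; apply/eqP; rewrite -[RHS]e.
non_commutative_ring.
Qed.

Let defect (a b : R) := d (a * b) - d a * b - a * d b.

Lemma defect_anti (a b : R) : defect b a = - defect a b.
Proof.
apply/eqP; rewrite -addr_eq0; apply/eqP.
have := jordan_anticomm b a; rewrite dD => /eqP; rewrite -subr_eq0 => /eqP <-.
rewrite /defect; non_commutative_ring.
Qed.

Lemma defectDl (a a' b : R) : defect (a + a') b = defect a b + defect a' b.
Proof. rewrite /defect mulrDl !dD; non_commutative_ring. Qed.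

Lemma defectDr (a b b' : R) : defect a (b + b') = defect a b + defect a b'.
Proof. rewrite /defect mulrDr !dD; non_commutative_ring. Qed.

Let commutator (a b : R) := a * b - b * a.

(** Compute [d] of [a b x b a + b a x a b] in two ways: as the triple product
    of [a b], [x] and [b a], and as the sum of [a (b x b) a] and [b (a x a) b].
    The difference is an anticommutation relation between the defect and the
    commutator of [a] and [b]. *)
Lemma defect_com (a b x : R) : defect a b * x * commutator a b = 0.
Proof.
move: x; apply: semiprime_anticommute => x.
have e : a * b * x * (b * a) + b * a * x * (a * b) =
    a * (b * x * b) * a + b * (a * x * a) * b.
  non_commutative_ring.
have := congr1 d e.
rewrite jordan_triple_lin dD !jordan_triple => /eqP; rewrite -subr_eq0 => /eqP e'.
have := defect_anti a b; rewrite /defect => /eqP; rewrite -subr_eq0 => /eqP e2.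
set z := d (a * b) - _ - _ in e2 *.
have e3 : d (a * b) = z + d a * b + a * d b by rewrite /z; non_commutative_ring.
have e4 : d (b * a) = - z + d b * a + b * d a.
  apply/eqP; rewrite -subr_eq0; apply/eqP; rewrite -[RHS]e2; non_commutative_ring.
rewrite e3 e4 in e'.
rewrite -[RHS]oppr0 -e' /commutator; non_commutative_ring.
Qed.

Let mul_sum2 (p q y r s : R) :
  (p + q) * y * (r + s) = p * y * r + p * y * s + (q * y * r + q * y * s).
Proof. non_commutative_ring. Qed.

(** Linearizing [defect_com] in its first variable exchanges [a] and [c] up to
    sign. For [t] the left-hand side, an exchange in the second factor of
    [t * y * t] creates a product that vanishes by [defect_com]. The next lemma
    repeats this in the second variable. *)
Lemma defect_com_l (a b c x : R) : defect a b * x * commutator c b = 0.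
Proof.
have lin y : defect a b * y * commutator c b = - (defect c b * y * commutator a b).
  apply/eqP; rewrite -addr_eq0; apply/eqP.
  have := defect_com (a + c) b y; rewrite defectDl.
  have -> : commutator (a + c) b = commutator a b + commutator c b by rewrite /commutator; non_commutative_ring.
  rewrite mul_sum2 !defect_com add0r addr0 => <-.
  by rewrite addrC.
apply: semiprime => y.
rewrite {2}lin mulrN.
have -> : defect a b * x * commutator c b * y * (defect c b * x * commutator a b) =
  defect a b * x * (commutator c b * y * defect c b) * x * commutator a b.
  non_commutative_ring.
by rewrite (semiprime_mul_sym (defect_com c b)) !(mulr0, mul0r) oppr0.
Qed.

Lemma defect_com_lr (a b c e x : R) : defect a b * x * commutator c e = 0.
Proof.
have lin y : defect a b * y * commutator c e = - (defect a e * y * commutator c b).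
  apply/eqP; rewrite -addr_eq0; apply/eqP.
  have := defect_com_l a (b + e) c y; rewrite defectDr.
  have -> : commutator c (b + e) = commutator c b + commutator c e by rewrite /commutator; non_commutative_ring.
  rewrite mul_sum2 !defect_com_l add0r addr0 => <-.
  by rewrite addrC.
apply: semiprime => y.
rewrite {2}lin mulrN.
have -> : defect a b * x * commutator c e * y * (defect a e * x * commutator c b) =
  defect a b * x * (commutator c e * y * defect a e) * x * commutator c b.
  non_commutative_ring.
by rewrite (semiprime_mul_sym (defect_com_l a e c)) !(mulr0, mul0r) oppr0.
Qed.

(** The defect [z] annihilates all commutators, hence is central. Applying [d]
    to [z c + c z = 0] for [c] the commutator of [a] and [b] gives
    [z^2 d(c) = 0], while [d(c)] is [2 z] plus commutators; so [z^3 = 0], and a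
    nilpotent central element of a semiprime ring is zero. *)
Theorem jordan_derivation_leibniz (a b : R) : d (a * b) = d a * b + a * d b.
Proof.
set z := defect a b.
have zcom x c e : z * x * commutator c e = 0 by exact: defect_com_lr.
have zC r : z * r = r * z.
  apply/eqP; rewrite -subr_eq0; apply/eqP; apply: semiprime => x.
  have -> : (z * r - r * z) * x * (z * r - r * z) =
      z * (r * x) * commutator z r - r * (z * x * commutator z r).
    rewrite /commutator; non_commutative_ring.
  by rewrite !zcom mulr0 subr0.
have zc c e : z * commutator c e = 0 by rewrite -[z]mulr1 zcom.
have dz2 : z * (z * d (commutator a b)) = 0.
  apply: torsion2.
  have /eqP := jordan_anticomm z (commutator a b).
  rewrite -zC zc addr0 jordan0 eq_sym => /eqP e0.
  have e1 : z * (d z * commutator a b + z * d (commutator a b) + (d (commutator a b) * z + commutator a b * d z)) = 0.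
    by rewrite e0 mulr0.
  have -> : z * (z * d (commutator a b)) + z * (z * d (commutator a b)) =
      z * (d z * commutator a b + z * d (commutator a b) + (d (commutator a b) * z + commutator a b * d z))
      - z * d z * commutator a b - z * commutator a b * d z
      + z * (z * d (commutator a b) - d (commutator a b) * z).
    non_commutative_ring.
  by rewrite e1 zcom zc (zC (d _)) !subrr mul0r mulr0 subr0 addr0.
have dc : d (commutator a b) = z + z + commutator (d a) b + commutator a (d b).
  have e1 := defect_anti a b; rewrite -/z in e1.
  have -> : d (commutator a b) = z - defect b a + commutator (d a) b + commutator a (d b).
    rewrite /z /defect /commutator dD jordanN; non_commutative_ring.
  by rewrite e1 opprK.
have z3 : z * z * z = 0.
  apply: torsion2.
  have -> : z * z * z + z * z * z =
      z * (z * d (commutator a b)) - z * (z * commutator (d a) b) - z * (z * commutator a (d b)).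
    rewrite dc; non_commutative_ring.
  by rewrite dz2 !zc !mulr0 !subr0.
have z2 : z * z = 0.
  apply: semiprime => x.
  have -> : z * z * x * (z * z) = z * z * (x * z) * z by non_commutative_ring.
  by rewrite -(zC x) !mulrA z3 !mul0r.
have z0 : z = 0.
  by apply: semiprime => x; rewrite -mulrA -(zC x) mulrA z2 mul0r.
have -> : d (a * b) = z + d a * b + a * d b.
  rewrite /z /defect; non_commutative_ring.
by rewrite z0 add0r.
Qed.
End JordanDerivations.

(** * Additivity of 2-local derivations on rings with a proper involution *)

Section TwoLocalStar.
Variables (R : pzRingType) (star : R -> R) (Der : (R -> R) -> Prop).
Variables (P : R -> Prop) (Delta : R -> R).
Hypothesis torsion2 : forall x : R, x + x = 0 -> x = 0.
Hypothesis starK : forall x, star (star x) = x.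
Hypothesis starM : forall x y, star (x * y) = star y * star x.
Hypothesis star_proper : forall x, star x * x = 0 -> x = 0.
Hypothesis DerD : forall D, Der D -> forall x y, D (x + y) = D x + D y.
Hypothesis DerM : forall D, Der D -> forall x y, D (x * y) = D x * y + x * D y.
Hypothesis DerB : forall D E, Der D -> Der E -> Der (fun x => D x - E x).
Hypothesis idemP : forall p, P p -> p * p = p.
Hypothesis starP : forall p, P p -> star p = p.
Hypothesis cornerC : forall p, P p -> forall x y,
  p * x * p * (p * y * p) = p * y * p * (p * x * p).
Hypothesis Der_corner : forall D p, Der D -> P p -> forall x, p * D (p * x * p) * p = 0.
Hypothesis P_faithful : forall w, (forall p, P p -> forall v, p * v * w = 0) -> w = 0.
Hypothesis Delta_local : forall x y, exists D, [/\ Der D, Delta x = D x & Delta y = D y].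

Lemma star0 : star 0 = 0.
Proof. by rewrite -(mul0r (star 0)) starM starK mul0r. Qed.

Lemma star_eq0 (x : R) : star x = 0 -> x = 0.
Proof. by move=> e; rewrite -[x]starK e star0. Qed.

Lemma star_proper_r (x : R) : x * star x = 0 -> x = 0.
Proof. by move=> e; apply/star_eq0/star_proper; rewrite starK. Qed.

Lemma star_semiprime (x : R) : (forall y, x * y * x = 0) -> x = 0.
Proof.
move=> h; apply/star_proper_r/star_proper_r.
by rewrite starM starK !mulrA h mul0r.
Qed.

(** [a * D x * b] is the trace of [D x * (b * a)], which should be the trace of
    [- x * D (b * a)], that is 0. For [x] in the ideal [R p R] the commutativity
    of the corner and [Der_corner] justify this ([on_ideal]). For general [x] it
    is applied to [r' * x * r], where [r = b * star b] and [r' = star a * a] lie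
    in the ideal and act on [b] and [a] as multiplication by elements of the
    corner; these are then cancelled by means of the proper involution and the
    commutativity of the corner. *)
Lemma derivation_sandwich_eq0 (D : R -> R) (p a b x : R) : Der D -> P p ->
  p * a = a -> b * p = b -> D (b * a) = 0 -> a * D x * b = 0.
Proof.
move=> hD hp pa bp Dba.
have Dm := DerM hD.
have pp := idemP hp; have sp := starP hp.
have pa' z : p * (a * z) = a * z by rewrite mulrA pa.
have bp' z : b * (p * z) = b * z by rewrite mulrA bp.
have pp' z : p * (p * z) = p * z by rewrite mulrA pp.
have F w : p * D (a * w * b) * p = 0.
  have -> : a * w * b = p * (a * w * b) * p by rewrite -!mulrA bp pa'.
  exact: Der_corner.
have on_ideal s t : a * D (s * p * t) * b = 0.
  rewrite -!mulrA; set w := s * (p * t).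
  have := F w; rewrite !Dm.
  have := cornerC hp (a * s) (t * D b).
  have := cornerC hp (D a * s) (t * b).
  rewrite -!mulrA !(pa', pp', pp, bp, bp').
  have e3 : p * (t * (D b * (a * (s * p)))) + p * (t * (b * (D a * (s * p)))) = 0.
    have := congr1 (fun z => p * t * z * (s * p)) Dba.
    by rewrite Dm mulr0 mul0r => <-; non_commutative_ring.
  move=> e1 e2.
  rewrite !(mulrDl, mulrDr) -?mulrA !(bp, pa', bp').
  rewrite /w in e1 e2 *; rewrite -?mulrA e2 e1 addrAC.
  by rewrite [X in X + _ = 0 -> _]addrC e3 add0r.
(* [r] and [r'] are kept opaque so that [D r] and [D r'] are not expanded. *)
have [r rE] : exists r, r = b * star b by exists (b * star b).
have [r' r'E] : exists r', r' = star a * a by exists (star a * a).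
(* The terms of the Leibniz rule in which [r] or [r'] is differentiated vanish. *)
have left_r s t : a * (s * p * t) * D r * b = 0.
  have := on_ideal s (t * r); rewrite mulrA Dm => e.
  rewrite -[RHS]e.
  have -> : a * (D (s * p * t) * r + s * p * t * D r) * b =
      a * D (s * p * t) * b * (star b * b) + a * (s * p * t) * D r * b.
    by rewrite rE; non_commutative_ring.
  by rewrite on_ideal mul0r add0r.
have right_r' s t : a * D r' * (s * p * t) * b = 0.
  have := on_ideal (r' * s) t; rewrite -!(mulrA r') Dm => e.
  rewrite -[RHS]e.
  have -> : a * (D r' * (s * p * t) + r' * D (s * p * t)) * b =
      a * D r' * (s * p * t) * b + a * star a * (a * D (s * p * t) * b).
    by rewrite {2}r'E; non_commutative_ring.
  by rewrite on_ideal mulr0 addr0.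
have key : a * star a * (a * D x * b) * (star b * b) = 0.
  have e : a * D (r' * (x * r)) * b = 0.
    have -> : r' * (x * r) = star a * p * (a * (x * r)) by rewrite r'E -!mulrA pa'.
    exact: on_ideal.
  rewrite -[RHS]e !Dm.
  have e1 : a * D r' * (x * b * p * star b) * b = 0 by exact: right_r'.
  have e2 : a * (star a * p * (a * x)) * D r * b = 0 by exact: left_r.
  have -> : a * (D r' * (x * r) + r' * (D x * r + x * D r)) * b =
      a * D r' * (x * b * p * star b) * b
      + a * star a * (a * D x * b) * (star b * b)
      + a * (star a * p * (a * x)) * D r * b.
    rewrite -(mulrA (star a)) pa' -(mulrA x b p) bp.
    move: (D r) (D r') (D x) => dr dr' dx; rewrite rE r'E; non_commutative_ring.
  by rewrite e1 e2 addr0 add0r.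
set c := a * D x * b in key *.
have pc : p * c = c by rewrite /c -!mulrA pa'.
have cp : c * p = c by rewrite /c -!mulrA bp.
(* From [f * c * e = 0] with [f = a * star a] and [e = star b * b], down to [c = 0]. *)
have corner u v : p * u = u -> u * p = u -> p * v = v -> v * p = v -> u * v = v * u.
  by move=> pu up pv vp; have := cornerC hp u v; rewrite pu up pv vp.
have ap : star a * p = star a by rewrite -{2}pa starM sp.
have pb : p * star b = star b by rewrite -{2}bp starM sp.
have cf : a * star a * c = c * (a * star a).
  by apply: corner; rewrite // ?mulrA ?pa -?mulrA ?ap.
have cs : star c * c = c * star c.
  apply: corner => //; first by rewrite -{2}cp starM sp.
  by rewrite -{2}pc starM sp.
have bcf : b * (c * (a * star a)) = 0.
  apply: star_proper; rewrite starM -mulrA (mulrA (star b)).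
  have -> : star b * b * (c * (a * star a)) = a * star a * c * (star b * b).
    rewrite cf; apply: corner; rewrite ?mulrA ?pb ?pc // -!mulrA ?bp ?ap //.
  by rewrite key mulr0.
have fcc : a * star a * (c * c) = 0.
  by rewrite mulrA cf -mulrA cf {1}/c -2!mulrA bcf !mulr0.
have acc : star a * (c * c) = 0.
  by apply: star_proper; rewrite starM starK -mulrA (mulrA a) fcc mulr0.
have ccc : star c * c * c = 0.
  have -> : star c = star b * star (D x) * star a by rewrite /c !starM mulrA.
  by rewrite -mulrA -(mulrA _ (star a)) acc mulr0.
apply/star_proper; apply/star_proper.
by rewrite starM starK {2}cs mulrA ccc mul0r.
Qed.

(** One derivation serves for all arguments of [Delta] at once: any other one
    that agrees with [Delta] at [y] and at [u * p * (p * v)] differs from it by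
    a derivation vanishing at the latter product. *)
Lemma two_local_sandwich (p v u : R) : P p -> exists2 D, Der D &
  forall x, p * v * Delta x * (u * p) = p * v * D x * (u * p).
Proof.
move=> hp.
have [D [hD _ e]] := Delta_local 0 (u * p * (p * v)).
exists D => // y; have [E [hE e1 e2]] := Delta_local y (u * p * (p * v)).
rewrite e1; apply/eqP; rewrite -subr_eq0 -mulrBl -mulrBr; apply/eqP.
apply: (@derivation_sandwich_eq0 (fun z => E z - D z) p (p * v) (u * p) y) => //.
- exact: DerB.
- by rewrite mulrA idemP.
- by rewrite -mulrA idemP.
- by rewrite -e -e2 subrr.
Qed.

Lemma two_local_additive (x y : R) : Delta (x + y) = Delta x + Delta y.
Proof.
apply/eqP; rewrite -subr_eq0; apply/eqP; apply: P_faithful => p hp v.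
apply: star_proper_r; rewrite !starM (starP hp) (mulrA (star _)).
have [D hD e] := two_local_sandwich v (star (Delta (x + y) - (Delta x + Delta y)) * star v) hp.
rewrite mulrBr mulrBl mulrDr mulrDl !e DerD // mulrDr mulrDl.
exact: subrr.
Qed.

Theorem two_local_derivation_leibniz (x y : R) :
  Delta (x * y) = Delta x * y + x * Delta y.
Proof.
apply: jordan_derivation_leibniz => //.
- exact: star_semiprime.
- exact: two_local_additive.
- move=> z; have [D [hD -> ->]] := Delta_local (z * z) z.
  exact: DerM.
Qed.

End TwoLocalStar.

(** * Real norm and real inner product *)

(** The norm and the inner product take values in [R[i]]; replacing them by
    their real parts makes real linear arithmetic available. *)
Section RealNorm.
Local Open Scope complex_scope.
Context {R : realType} {H : completeNormedModType R[i]}.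
Implicit Types (u v w : H) (r s : R) (a : R[i]).

Definition rnorm u : R := complex.Re `|u|.

Lemma normE u : `|u| = (rnorm u)%:C.
Proof. exact: esym (RRe_real (normr_real u)). Qed.

Lemma rnorm_ge0 u : 0 <= rnorm u.
Proof. by have := normr_ge0 u; rewrite normE ler0c. Qed.

Lemma rnorm0 : rnorm 0 = 0.
Proof. by rewrite /rnorm normr0. Qed.

Lemma rnorm_eq0 u : rnorm u = 0 -> u = 0.
Proof. by move=> e; apply/normr0_eq0; rewrite normE e. Qed.

Lemma rnormD u v : rnorm (u + v) <= rnorm u + rnorm v.
Proof. by have := ler_normD u v; rewrite !normE -(rmorphD (real_complex R)) lecR. Qed.

Lemma rnormN u : rnorm (- u) = rnorm u.
Proof. by rewrite /rnorm normrN. Qed.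

Lemma rnormBC u v : rnorm (u - v) = rnorm (v - u).
Proof. by rewrite -rnormN opprB. Qed.

Lemma rnorm_triangle w u v : rnorm (u - v) <= rnorm (u - w) + rnorm (w - v).
Proof. by have := rnormD (u - w) (w - v); rewrite subrKA. Qed.

Lemma rnormZ r u : rnorm (r%:C *: u) = `|r| * rnorm u.
Proof.
apply: complexI; rewrite -normE normrZ rmorphM /= -normE; congr (_ * _).
by rewrite normc_def /= expr0n /= addr0 sqrtr_sqr.
Qed.

Lemma rnormZc a u : rnorm (a *: u) = complex.Re `|a| * rnorm u.
Proof.
apply: complexI; rewrite -normE normrZ normE rmorphM; congr (_ * _).
Qed.

Lemma Re_norm_ge0 a : 0 <= complex.Re `|a|.
Proof. by rewrite normc_def /= sqrtr_ge0. Qed.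

Section Inner.
Variable ip : {dot H for Num.Def.conjC}.
Hypothesis hip : inner_product_norm ip.

Definition re_inner u v : R := complex.Re (ip u v).
Local Notation rip := re_inner.

Lemma ipC u v : ip u v = (ip v u)^*%C.
Proof. by rewrite hermC expr0 mul1r. Qed.

Lemma ripC u v : rip u v = rip v u.
Proof. by rewrite /re_inner ipC; case: (ip v u). Qed.

Lemma ripDl u v w : rip (u + v) w = rip u w + rip v w.
Proof. by rewrite /re_inner linearDl raddfD. Qed.

Lemma ripZl r u v : rip (r%:C *: u) v = r * rip u v.
Proof. by rewrite /re_inner linearZl_LR /=; case: (ip u v) => x y /=; rewrite mul0r subr0. Qed.

Lemma rnorm2 u : rnorm u ^+ 2 = rip u u.
Proof.
apply: complexI; rewrite rmorphXn /= -normE hip /re_inner RRe_real //.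
by rewrite ger0_real // dnorm_ge0.
Qed.

Lemma rip_i u v : rip ('i%C *: u) v = - complex.Im (ip u v).
Proof. by rewrite /re_inner linearZl_LR /= mulrC ReiNIm. Qed.

Lemma ripDr u v w : rip u (v + w) = rip u v + rip u w.
Proof. by rewrite !(ripC u) ripDl. Qed.

Lemma ripZr r u v : rip u (r%:C *: v) = r * rip u v.
Proof. by rewrite !(ripC u) ripZl. Qed.

Lemma ripNl u v : rip (- u) v = - rip u v.
Proof. by rewrite /re_inner linearNl raddfN. Qed.

Lemma ripNr u v : rip u (- v) = - rip u v.
Proof. by rewrite !(ripC u) ripNl. Qed.

Lemma rip0l v : rip 0 v = 0.
Proof. by rewrite /re_inner linear0l. Qed.

Lemma rip0r v : rip v 0 = 0.
Proof. by rewrite ripC rip0l. Qed.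

Lemma rip_eq0 u : rip u u = 0 -> u = 0.
Proof. by rewrite -rnorm2 => /eqP; rewrite expf_eq0 /= => /eqP/rnorm_eq0. Qed.

Lemma rip_ge0 u : 0 <= rip u u.
Proof. by rewrite -rnorm2 exprn_ge0// rnorm_ge0. Qed.

Lemma rip_le u v : rip u v <= rnorm u * rnorm v.
Proof.
have h := rnormD u v.
have : rnorm (u + v) ^+ 2 <= (rnorm u + rnorm v) ^+ 2.
  by rewrite ler_sqr ?nnegrE ?addr_ge0 ?rnorm_ge0.
rewrite sqrrD !rnorm2 !ripDl !ripDr (ripC v u); lra.
Qed.

Lemma parallelogram u v :
  rnorm (u - v) ^+ 2 + rnorm (u + v) ^+ 2 = 2 * rnorm u ^+ 2 + 2 * rnorm v ^+ 2.
Proof. by rewrite !rnorm2 !(ripDl, ripDr, ripNl, ripNr); ring. Qed.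

Lemma rip_inj u v : (forall w, rip u w = rip v w) -> u = v.
Proof.
move=> h; apply/eqP; rewrite -subr_eq0; apply/eqP/rip_eq0.
by rewrite ripDl ripNl h subrr.
Qed.

(** The imaginary part of [ip u v] is, up to sign, the real part of
    [ip ('i *: u) v]. *)
Lemma adjoint_of_rip (x y : H -> H) : linear x ->
  (forall u v, rip (x u) v = rip u (y v)) -> adjoint_of ip x y.
Proof.
move=> lx h u v; have := h u v; have := h ('i%C *: u) v.
have -> : x ('i%C *: u) = 'i%C *: x u.
  have x0 : x 0 = 0.
    by have := lx 1 0 0; rewrite !scale1r addr0 => /esym/(canRL (addrK _)); rewrite subrr.
  by have := lx 'i%C u 0; rewrite !addr0 x0 addr0.
rewrite !rip_i /re_inner; case: (ip (x u) v) (ip u (y v)) => [a b] [c e] /= be ac.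
by congr Complex => //; apply: oppr_inj.
Qed.

End Inner.

Lemma rnorm_le_eq0 u : (forall e, 0 < e -> rnorm u <= e) -> u = 0.
Proof.
move=> h; apply: rnorm_eq0; apply: le_anti; rewrite rnorm_ge0 andbT.
by apply/ler_addgt0Pr => e e0; rewrite add0r h.
Qed.

Lemma invSn_small (e : R) : 0 < e -> exists n : nat, n.+1%:R^-1 <= e.
Proof.
move=> e0; exists (Num.bound e^-1).
have e'0 : 0 <= e^-1 by rewrite invr_ge0 ltW.
rewrite invf_ple ?posrE//; apply: ltW; apply: lt_trans (archi_boundP e'0) _.
by rewrite ltr_nat.
Qed.

(** The modulus [e] is kept because both constructions by successive
    approximation below need error bounds at every stage. *)
Lemma cauchy_limit (f : nat -> H) (e : nat -> R) :
  (forall m n, (n <= m)%N -> rnorm (f m - f n) <= e n) ->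
  (forall s, 0 < s -> exists n, e n <= s) ->
  exists l, forall n, rnorm (f n - l) <= e n.
Proof.
move=> hf he.
have : cauchy (f @ \oo).
  apply: cauchy_exP => eps eps0.
  have epsE : eps = (complex.Re eps)%:C by rewrite RRe_real// gtr0_real.
  have r0 : 0 < complex.Re eps by rewrite -ltcR -epsE.
  have r2 : 0 < complex.Re eps / 2 by lra.
  have [n hn] := he _ r2.
  exists (f n); exists n => // k /= nk.
  rewrite -ball_normE /ball_ /= normE epsE ltcR rnormBC.
  by have := hf _ _ nk; lra.
move=> /cauchy_cvgP /cvg_ex [l hl]; exists l => n.
apply/ler_addgt0Pr => s s0.
have : (0 : R[i]) < s%:C by rewrite ltcR.
move/cvgrPdist_le : hl => /[apply] -[N _ hN].
have := hN (maxn n N) (leq_maxr _ _); rewrite /= normE lecR => h1.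
have := hf (maxn n N) n (leq_maxl _ _); rewrite rnormBC => h2.
by have := rnorm_triangle (f (maxn n N)) (f n) l; rewrite (rnormBC (f (maxn n N)) l); lra.
Qed.
End RealNorm.

(** * Orthogonal projections *)

Section LinearMaps.
Context {K : pzRingType} {U : lmodType K}.
Variable x : U -> U.
Hypothesis lx : linear x.

Lemma lin0 : x 0 = 0.
Proof.
by have := lx 1 0 0; rewrite !scale1r addr0 => /esym/(canRL (addrK _)); rewrite subrr.
Qed.

Lemma linD u v : x (u + v) = x u + x v.
Proof. by have := lx 1 u v; rewrite !scale1r. Qed.

Lemma linZ a u : x (a *: u) = a *: x u.
Proof. by have := lx a u 0; rewrite !addr0 lin0 addr0. Qed.

Lemma linN u : x (- u) = - x u.
Proof. by rewrite -!scaleN1r linZ. Qed.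

Lemma linB u v : x (u - v) = x u - x v.
Proof. by rewrite linD linN. Qed.
End LinearMaps.

Section Projections.
Local Open Scope complex_scope.
Context {R : realType} {H : completeNormedModType R[i]}.
Variable ip : {dot H for Num.Def.conjC}.
Hypothesis hip : inner_product_norm ip.
Implicit Types (u v w : H) (x y : H -> H) (V : set H).
Local Notation rip := (re_inner ip).

Lemma bounded_rnorm x : bounded_operator x ->
  exists K : R, 0 < K /\ forall u, rnorm (x u) <= K * rnorm u.
Proof.
move=> [_ [k hk]]; exists (complex.Re `|k| + 1); have k0 := Re_norm_ge0 k.
split=> [|u]; first lra.
have : rnorm (x u) <= complex.Re `|k| * rnorm u.
  have kE : `|k| = (complex.Re `|k|)%:C by exact: esym (RRe_real (normr_real k)).
  rewrite -lecR rmorphM /= -!normE -kE; apply: le_trans (hk u) _.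
  have [ku|ku] := boolP (0 <= k); first by rewrite ger0_norm.
  have u0 : `|u| = 0.
    apply/eqP; apply: contraNT ku => un0.
    have : 0 <= k * `|u| by apply: le_trans (hk u).
    by rewrite pmulr_lge0 // lt_def un0 normr_ge0.
  by rewrite u0 !mulr0.
by have := rnorm_ge0 u; lra.
Qed.

Lemma rnorm_bounded x (K : R) : linear x ->
  (forall u, rnorm (x u) <= K * rnorm u) -> bounded_operator x.
Proof.
move=> lx h; split=> //; exists K%:C => u.
by rewrite !normE -(rmorphM (real_complex R)) lecR.
Qed.

Definition subspace V := V 0 /\ forall a u v, V u -> V v -> V (a *: u + v).

Lemma subspaceB V u v : subspace V -> V u -> V v -> V (u - v).
Proof. by move=> [_ VD] hu hv; rewrite addrC -scaleN1r; exact: VD. Qed.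

(** Membership in the closure of [V], in terms of [rnorm]. *)
Definition adherent V w := forall e : R, 0 < e -> exists2 v, V v & rnorm (w - v) <= e.

(** The projection theorem: a minimizing sequence of the distance from [u] to
    [V] is Cauchy by the parallelogram law, and a first-order variation at the
    limit gives orthogonality. *)
Lemma closest_point V u : subspace V ->
  exists2 w, adherent V w & forall v, V v -> rip (u - w) v = 0.
Proof.
move=> [V0 VD].
have VZ a v : V v -> V (a *: v) by move=> Vv; rewrite -[_ *: _]addr0; exact: VD.
have VA v v' : V v -> V v' -> V (v + v').
  by move=> h h'; have := VD 1 _ _ h h'; rewrite scale1r.
pose E := [set rnorm (u - v) | v in V].
have Ei : has_inf E.
  by split; [exists (rnorm (u - 0)), 0 | exists 0 => _ [v _ <-]; exact: rnorm_ge0].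
set d := inf E.
have d0 : 0 <= d by apply: lb_le_inf; [case: Ei | move=> _ [v _ <-]; exact: rnorm_ge0].
have dle v : V v -> d <= rnorm (u - v).
  by move=> Vv; apply: ge_inf; [case: Ei | exists v].
have [i [i0 i1 ile ismall]] : exists i : nat -> R, [/\ forall n, 0 < i n,
    forall n, i n <= 1, forall m n, (n <= m)%N -> i m <= i n &
    forall e, 0 < e -> exists n, i n <= e].
  exists (fun n => n.+1%:R^-1); split; [move=> n| move=> n| move=> m n nm|].
  - by rewrite invr_gt0 ltr0Sn.
  - by rewrite invf_le1 ?ltr0Sn // ler1n.
  - by rewrite lef_pV2 ?posrE ?ltr0Sn // ler_nat.
  - exact: invSn_small.
(* The tolerance [t n] is chosen so that the parallelogram law bounds the
   squared distances between later terms of the minimizing sequence by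
   [8 d (t n) + 4 (t n)^2], which is at most [(i n)^2]. *)
pose t n : R := (8 * d + 4)^-1 * i n ^+ 2.
have t0 n : 0 < t n.
  by rewrite mulr_gt0 ?exprn_gt0 ?invr_gt0 //; lra.
have tE n : (8 * d + 4) * t n = i n ^+ 2.
  by rewrite /t mulrA mulfV ?mul1r //; apply: lt0r_neq0; lra.
have tle m n : (n <= m)%N -> t m <= t n.
  move=> nm; rewrite ler_pM2l ?invr_gt0; last lra.
  by rewrite ler_sqr ?nnegrE ?(ltW (i0 _)) // ile.
clearbody t.
have /choice [f hf] : forall n, exists v, V v /\ rnorm (u - v) < d + t n.
  move=> n; have [_ [v Vv <-] h] := inf_adherent (t0 n) Ei.
  by exists v.
have t1 n : t n <= i n.
  have ii : i n ^+ 2 <= i n by rewrite expr2 ler_piMr // ltW.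
  have dt : 0 <= d * t n by rewrite mulr_ge0 // ltW.
  by have := t0 n; have := tE n; move: ii dt; lra.
have [w hw] : exists w, forall n, rnorm (f n - w) <= i n.
  apply: cauchy_limit => [m n nm|]; last exact: ismall.
  have [Vm hm] := hf m; have [Vn hn] := hf n.
  have tmn := tle _ _ nm.
  have := dle (2^-1%:C *: (f m + f n)) (VZ _ _ (VA _ _ Vm Vn)).
  have -> : u - 2^-1%:C *: (f m + f n) = 2^-1%:C *: ((u - f n) + (u - f m)).
    rewrite addrACA -opprD scalerBr (addrC (f n)); congr (_ - _).
    rewrite scalerDr -scalerDl -rmorphD /=.
    by have -> : 2^-1 + 2^-1 = 1 :> R; [lra | rewrite scale1r].
  rewrite rnormZ ger0_norm ?invr_ge0 ?ler0n // => hd.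
  have := parallelogram hip (u - f n) (u - f m).
  have -> : u - f n - (u - f m) = f m - f n.
    by rewrite opprB addrC addrA subrK.
  move=> hp; rewrite -ler_sqr ?nnegrE ?rnorm_ge0 ?(ltW (i0 n)) // -tE.
  have S2 : (2 * d) ^+ 2 <= rnorm (u - f n + (u - f m)) ^+ 2.
    by rewrite ler_sqr ?nnegrE ?rnorm_ge0 ?mulr_ge0 //; lra.
  have sq v : rnorm (u - v) < d + t n -> rnorm (u - v) ^+ 2 <= (d + t n) ^+ 2.
    by move=> h; rewrite ler_sqr ?nnegrE ?rnorm_ge0 ?addr_ge0 // ltW.
  have t2 : t n ^+ 2 <= t n.
    by rewrite expr2 ler_piMr // ?(ltW (t0 n)) // (le_trans (t1 n)).
  have := sq _ hn; have /sq := lt_le_trans hm (lerD (lexx d) tmn).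
  by move: S2 t2 hp; rewrite exprMn sqrrD; lra.
exists w.
  move=> e e0; have [n hn] := ismall _ e0.
  by exists (f n); [case: (hf n) | rewrite rnormBC; apply: le_trans hn].
have uw : rnorm (u - w) <= d.
  apply/ler_addgt0Pr => e e0.
  have e2 : 0 < e / 2 by lra.
  have [n hn] := ismall _ e2; have [_ h1] := hf n.
  by have := t1 n; have := hw n; have := rnorm_triangle (f n) u w; lra.
have lo v : V v -> d <= rnorm (u - w - v).
  move=> Vv; apply/ler_addgt0Pr => e e0; have [n hn] := ismall _ e0.
  have [Vn _] := hf n; have h1 := dle _ (VA _ _ Vn Vv).
  have := rnormD (u - w - v) (w - f n).
  have -> : u - w - v + (w - f n) = u - (f n + v).
    by rewrite addrAC addrA subrK opprD addrA.
  by have := hw n; rewrite rnormBC; lra.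
move=> v Vv.
have [->|v0] := eqVneq v 0; first exact: rip0r.
have vv0 : 0 < rip v v.
  by rewrite lt_def rip_ge0 // andbT; apply: contra v0 => /eqP/rip_eq0->.
move: uw lo; move: (u - w) => z uw lo.
(* [r *: v] is the component of [z] along [v]; removing it would shorten [z]. *)
pose r := rip z v / rip v v.
have rE : r * rip v v = rip z v by rewrite /r divfK // gt_eqF.
have : rnorm z ^+ 2 <= rnorm (z - r%:C *: v) ^+ 2.
  rewrite ler_sqr ?nnegrE ?rnorm_ge0 //; apply: le_trans uw (lo _ _).
  exact: VZ.
rewrite !(rnorm2 hip) !(ripDl, ripDr, ripNl, ripNr, ripZl, ripZr) (ripC _ v z).
rewrite -rE => h.
have : r * r * rip v v <= 0 by move: h; lra.
rewrite pmulr_lle0 // => r2.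
have -> : r = 0 by nra.
by rewrite mul0r.
Qed.

Definition orth V : set H := [set w | forall v, V v -> rip w v = 0].

Lemma ripZ_conj (a : R[i]) u v : rip (a *: u) v = rip u (a^*%C *: v).
Proof.
rewrite /re_inner linearZl_LR linearZr_LR /=; congr (complex.Re (_ * _)).
exact: esym (conjcK a).
Qed.

Lemma subspace_orth V : subspace V -> subspace (orth V).
Proof.
move=> [V0 VD]; split=> [v _|a u v hu hv w Vw]; first exact: rip0l.
rewrite ripDl ripZ_conj hu ?hv ?addr0 //.
by rewrite -[_ *: _]addr0; apply: VD.
Qed.

Lemma subspace_adherent V : subspace V -> subspace (adherent V).
Proof.
move=> [V0 VD]; split=> [e e0|a u v hu hv e e0].
  by exists 0 => //; rewrite subr0 rnorm0 ltW.
have a0 := Re_norm_ge0 a.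
have e1 : 0 < e / 2 / (complex.Re `|a| + 1) by rewrite divr_gt0 //; lra.
have e2 : 0 < e / 2 by lra.
have [u' Vu' hu'] := hu _ e1; have [v' Vv' hv'] := hv _ e2.
exists (a *: u' + v'); first exact: VD.
rewrite opprD addrACA -scalerBr; apply: le_trans (rnormD _ _) _.
rewrite rnormZc.
have : complex.Re `|a| * rnorm (u - u') <= e / 2.
  have -> : e / 2 = (complex.Re `|a| + 1) * (e / 2 / (complex.Re `|a| + 1)).
    by rewrite [RHS]mulrC divfK // gt_eqF //; lra.
  by apply: ler_pM; rewrite ?rnorm_ge0 //; lra.
lra.
Qed.

Lemma orth_adherent V w z : adherent V w -> orth V z -> rip z w = 0.
Proof.
have half z' : adherent V w -> orth V z' -> rip z' w <= 0.
  move=> hw hz; apply/ler_addgt0Pr => e e0; rewrite add0r.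
  have n0 := rnorm_ge0 z'.
  have e1 : 0 < e / (rnorm z' + 1) by rewrite divr_gt0 //; lra.
  have [v Vv hv] := hw _ e1.
  have -> : rip z' w = rip z' (w - v) by rewrite ripDr ripNr (hz v Vv) subr0.
  apply: le_trans (rip_le hip _ _) _.
  have -> : e = (rnorm z' + 1) * (e / (rnorm z' + 1)).
    by rewrite [RHS]mulrC divfK // gt_eqF //; lra.
  by apply: ler_pM; rewrite ?rnorm_ge0 //; lra.
move=> hw hz; apply: le_anti; rewrite half //= -oppr_le0 -ripNl half //.
by move=> v Vv; rewrite ripNl hz // oppr0.
Qed.

Lemma orth_adherent_eq0 V w : adherent V w -> orth V w -> w = 0.
Proof. by move=> hw ow; apply/rip_eq0/(orth_adherent hw ow). Qed.

(** [q] is the orthogonal projection onto the closure of [V]. *)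
Definition is_projection_onto V (q : H -> H) : Prop :=
  [/\ bounded_operator q, adjoint_of ip q q,
     forall u, adherent V (q u) & forall u, orth V (u - q u)].

Lemma projection_unique V q u w : subspace V -> is_projection_onto V q ->
  adherent V w -> orth V (u - w) -> q u = w.
Proof.
move=> sV [_ _ qa qo] hw ow; apply/eqP; rewrite -subr_eq0; apply/eqP.
apply: (@orth_adherent_eq0 V).
  by apply: (subspaceB (subspace_adherent sV)).
have -> : q u - w = (u - w) - (u - q u) by rewrite opprB [RHS]addrC subrKA.
by apply: (subspaceB (subspace_orth sV)).
Qed.

Lemma projection_exists V : subspace V -> exists q, is_projection_onto V q.
Proof.
move=> sV.
have /choice [q hq] : forall u, exists w, adherent V w /\ orth V (u - w).
  by move=> u; have [w h1 h2] := closest_point u sV; exists w.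
have qa u : adherent V (q u) by case: (hq u).
have qo u : orth V (u - q u) by case: (hq u).
have lq : linear q.
  move=> a u v; apply/eqP; rewrite -subr_eq0; apply/eqP.
  apply: (@orth_adherent_eq0 V).
    apply: (subspaceB (subspace_adherent sV)) => //; exact: (subspace_adherent sV).2.
  have -> : q (a *: u + v) - (a *: q u + q v) =
      (a *: (u - q u) + (v - q v)) - (a *: u + v - q (a *: u + v)).
    by rewrite scalerBr addrACA -opprD opprB [RHS]addrC subrKA.
  apply: (subspaceB (subspace_orth sV)) => //; exact: (subspace_orth sV).2.
have qrip u v : rip (q u) v = rip (q u) (q v).
  apply/eqP; rewrite -subr_eq0 -ripNr -ripDr; apply/eqP.
  by rewrite ripC (orth_adherent (qa u)).
exists q; split=> //.
  apply: (@rnorm_bounded _ 1) => // u; rewrite mul1r.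
  have := rip_le hip (q u) u; rewrite qrip -(rnorm2 hip) expr2.
  have [->|n0] := eqVneq (rnorm (q u)) 0; first by rewrite rnorm_ge0.
  by rewrite ler_pM2l // lt_def n0 rnorm_ge0.
apply: (adjoint_of_rip lq) => u v.
by rewrite qrip [RHS]ripC [RHS]qrip ripC.
Qed.

Lemma projection_id V q u : subspace V -> is_projection_onto V q ->
  adherent V u -> q u = u.
Proof.
move=> sV hq hu; apply: (projection_unique sV hq hu); rewrite subrr.
exact: (subspace_orth sV).1.
Qed.

Lemma projection_orth V q u : subspace V -> is_projection_onto V q ->
  orth V u -> q u = 0.
Proof.
move=> sV hq hu; apply: (projection_unique sV hq (subspace_adherent sV).1).
by rewrite subr0.
Qed.

(** Invariance of [orth V] under [x] stands for invariance of [V] under the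
    adjoint of [x]; it can be checked directly for elements of a commutant. *)
Lemma projection_comm V q x u : subspace V -> is_projection_onto V q ->
  bounded_operator x -> (forall v, V v -> V (x v)) ->
  (forall v, orth V v -> orth V (x v)) -> q (x u) = x (q u).
Proof.
move=> sV hq bx xV xo; have [_ _ qa qo] := hq; apply: (projection_unique sV hq).
  have [K [K0 hK]] := bounded_rnorm bx.
  move=> e e0; have [|v Vv hv] := qa u (e / K); first by rewrite divr_gt0.
  exists (x v); first exact: xV.
  rewrite -(linB bx.1); apply: le_trans (hK _) _.
  by rewrite mulrC -ler_pdivlMr.
by rewrite -(linB bx.1); exact: xo (qo u).
Qed.

End Projections.

(** * Square roots *)

Section SquareRoot.
Local Open Scope complex_scope.
Context {R : realType} {H : completeNormedModType R[i]}.
Variable ip : {dot H for Num.Def.conjC}.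
Hypothesis hip : inner_product_norm ip.
Local Notation rip := (re_inner ip).

(** The iteration [y := (x + y^2) / 2] converges to [1 - sqrt (1 - x)]. The
    scalar iteration at [x = 1] majorizes the norms of the iterates and of their
    successive differences, for any operator [x] of norm at most 1. *)
Fixpoint sqrt_scalar n : R :=
  if n is m.+1 then (1 + sqrt_scalar m ^+ 2) / 2 else 0.

Lemma sqrt_scalar_bounds n : 0 <= sqrt_scalar n <= 1.
Proof.
elim: n => [|n /andP[h0 h1]] /=; first by rewrite lexx ler01.
by apply/andP; split; nra.
Qed.

Lemma sqrt_scalar_incr m n : (n <= m)%N -> sqrt_scalar n <= sqrt_scalar m.
Proof.
move=> /subnK <-; elim: (m - n)%N => [|k IH] //=; apply: le_trans IH _.
by have := sqr_ge0 (1 - sqrt_scalar (k + n)); rewrite sqrrB; lra.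
Qed.

(** As long as [1 - t] stays above [e], each step [t |-> (1 + t^2) / 2]
    decreases it by at least [e^2 / 2]. *)
Lemma sqrt_scalar_cvg (e : R) : 0 < e -> exists n, 1 - sqrt_scalar n <= e.
Proof.
move=> e0; apply: contrapT => hn.
have low n : e <= 1 - sqrt_scalar n.
  by rewrite leNgt; apply/negP => h; apply: hn; exists n; exact: ltW.
have dec n : 1 - sqrt_scalar n <= 1 - n%:R * (e ^+ 2 / 2).
  elim: n => [|n IH]; first by rewrite mul0r.
  have h := low n; have hh : e ^+ 2 <= (1 - sqrt_scalar n) ^+ 2.
    by rewrite ler_sqr ?nnegrE //; lra.
  by rewrite -natr1 /=; move: hh IH; rewrite sqrrB; lra.
have e2 : 0 <= (e ^+ 2 / 2)^-1 by rewrite invr_ge0 divr_ge0 ?sqr_ge0.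
have := archi_boundP e2; set N := Num.bound _ => hN.
have hN1 : 1 < N%:R * (e ^+ 2 / 2).
  by rewrite -ltr_pdivrMr ?div1r // divr_gt0 // exprn_gt0.
by have := dec N; have := low N; lra.
Qed.

Variable x : H -> H.
Hypothesis lx : linear x.
Hypothesis x_self : forall u v, rip (x u) v = rip u (x v).
Hypothesis x_contr : forall u, rnorm (x u) <= rnorm u.

Fixpoint sqrt_iter n : H -> H :=
  if n is m.+1 then fun u => 2^-1%:C *: (x u + sqrt_iter m (sqrt_iter m u))
  else fun=> 0.

Lemma half_ge0 : `|2^-1 : R| = 2^-1.
Proof. by rewrite ger0_norm // invr_ge0. Qed.

Lemma sqrt_iter_linear n : linear (sqrt_iter n).
Proof.
elim: n => [|n IH] a u v /=; first by rewrite scaler0 addr0.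
by rewrite lx !IH addrACA -scalerDr [LHS]scalerDr !scalerA [a * _]mulrC.
Qed.

Lemma sqrt_iter_self n u v : rip (sqrt_iter n u) v = rip u (sqrt_iter n v).
Proof.
elim: n u v => [|n IH] u v /=; first by rewrite rip0l rip0r.
by rewrite ripZl ripZr ripDl ripDr x_self !IH.
Qed.

Lemma sqrt_iter_comm (z : H -> H) n u : linear z -> (forall v, x (z v) = z (x v)) ->
  sqrt_iter n (z u) = z (sqrt_iter n u).
Proof.
move=> lz hz; elim: n u => [|n IH] u /=; first by rewrite (lin0 lz).
by rewrite hz !IH (linZ lz) (linD lz).
Qed.

Lemma sqrt_iter_norm n u : rnorm (sqrt_iter n u) <= sqrt_scalar n * rnorm u.
Proof.
elim: n u => [|n IH] u /=; first by rewrite rnorm0 mul0r.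
have /andP[t0 _] := sqrt_scalar_bounds n.
rewrite rnormZ half_ge0.
have h1 := rnormD (x u) (sqrt_iter n (sqrt_iter n u)); have h2 := x_contr u.
have h3 := IH (sqrt_iter n u).
have h4 : sqrt_scalar n * rnorm (sqrt_iter n u) <= sqrt_scalar n * (sqrt_scalar n * rnorm u).
  by rewrite ler_wpM2l.
by lra.
Qed.

(** The increment [y'^2 - y^2] splits as [y' (y' - y) + (y' - y) y], the same
    identity as for the majorizing scalars. *)
Lemma sqrt_iter_diff n u : rnorm (sqrt_iter n.+1 u - sqrt_iter n u) <=
  (sqrt_scalar n.+1 - sqrt_scalar n) * rnorm u.
Proof.
elim: n u => [|n IH] u.
  rewrite /= subr0 addr0 rnormZ half_ge0; have := x_contr u; lra.
set y' := sqrt_iter n.+1; set y := sqrt_iter n in IH *.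
have -> : sqrt_iter n.+2 u - y' u =
    2^-1%:C *: (y' (y' u - y u) + (y' (y u) - y (y u))).
  have ly' : linear y' := sqrt_iter_linear n.+1.
  rewrite (linB ly') subrKA.
  rewrite [sqrt_iter n.+2]/= -/y' [X in _ - X]/= -/y -scalerBr.
  by rewrite opprD addrACA subrr add0r.
rewrite rnormZ half_ge0.
have h1 := rnormD (y' (y' u - y u)) (y' (y u) - y (y u)).
have h2 := sqrt_iter_norm n.+1 (y' u - y u).
have h3 := IH (y u); have h4 := IH u; have h5 := sqrt_iter_norm n u.
have /andP[t0 _] := sqrt_scalar_bounds n.
have /andP[t'0 _] := sqrt_scalar_bounds n.+1.
have h6 : sqrt_scalar n.+1 * rnorm (y' u - y u) <=
    sqrt_scalar n.+1 * ((sqrt_scalar n.+1 - sqrt_scalar n) * rnorm u).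
  by rewrite ler_wpM2l.
have h7 : (sqrt_scalar n.+1 - sqrt_scalar n) * rnorm (y u) <=
    (sqrt_scalar n.+1 - sqrt_scalar n) * (sqrt_scalar n * rnorm u).
  by rewrite ler_wpM2l // subr_ge0 sqrt_scalar_incr.
have -> : sqrt_scalar n.+2 = (1 + sqrt_scalar n.+1 ^+ 2) / 2 by [].
have e1 : sqrt_scalar n.+1 * rnorm u = (1 + sqrt_scalar n ^+ 2) / 2 * rnorm u by [].
rewrite -/y' in h2; rewrite -/y in h5.
move: h1 h2 h3 h6 h7 e1; rewrite -/y'.
move: (sqrt_scalar n.+1) (sqrt_scalar n) (rnorm u) => t' t r; lra.
Qed.

Lemma sqrt_iter_cauchy m n u : (n <= m)%N ->
  rnorm (sqrt_iter m u - sqrt_iter n u) <= (sqrt_scalar m - sqrt_scalar n) * rnorm u.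
Proof.
move=> /subnK <-; elim: (m - n)%N => [|k IH]; first by rewrite !subrr rnorm0 mul0r.
rewrite addSn; have := sqrt_iter_diff (k + n) u.
have := rnorm_triangle (sqrt_iter (k + n) u) (sqrt_iter (k + n).+1 u) (sqrt_iter n u).
by move: IH; lra.
Qed.

Lemma eq_of_sqrt_rate (a b : H) (C : R) :
  (forall n, rnorm (a - b) <= C * (1 - sqrt_scalar n)) -> a = b.
Proof.
move=> h; apply/eqP; rewrite -subr_eq0; apply/eqP/rnorm_le_eq0 => e e0.
have c1 : 0 < `|C| + 1 by rewrite ltr_wpDl.
have [n hn] := sqrt_scalar_cvg (divr_gt0 e0 c1).
have /andP[_ t1] := sqrt_scalar_bounds n.
apply: le_trans (h n) _; apply: (@le_trans _ _ ((`|C| + 1) * (e / (`|C| + 1)))).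
  apply: (@le_trans _ _ ((`|C| + 1) * (1 - sqrt_scalar n))).
    by rewrite ler_wpM2r ?subr_ge0 // (le_trans (ler_norm _)) // lerDl.
  by rewrite ler_pM2l.
by rewrite [leLHS]mulrC divfK // gt_eqF.
Qed.

Lemma sqrt_iter_limit : exists y : H -> H,
  [/\ linear y, forall u v, rip (y u) v = rip u (y v),
      forall u, rnorm (y u) <= rnorm u,
      forall u, y u + y u = x u + y (y u) &
      forall z, bounded_operator z -> (forall v, x (z v) = z (x v)) ->
        forall u, y (z u) = z (y u)].
Proof.
have /choice [y hy] : forall u, exists l, forall n,
    rnorm (sqrt_iter n u - l) <= (1 - sqrt_scalar n) * rnorm u.
  move=> u; have u0 := rnorm_ge0 u.
  apply: cauchy_limit => [m n /sqrt_iter_cauchy h|s s0].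
    apply: le_trans (h u) _; rewrite ler_wpM2r // lerB //.
    by have /andP[] := sqrt_scalar_bounds m.
  have u1 : 0 < rnorm u + 1 by lra.
  have [n hn] := sqrt_scalar_cvg (divr_gt0 s0 u1); exists n.
  have /andP[_ t1] := sqrt_scalar_bounds n.
  apply: (@le_trans _ _ (s / (rnorm u + 1) * (rnorm u + 1))).
    by apply: ler_pM => //; lra.
  by rewrite divfK // gt_eqF.
have ly : linear y.
  move=> a u v.
  apply: (@eq_of_sqrt_rate _ _
    (rnorm (a *: u + v) + complex.Re `|a| * rnorm u + rnorm v)) => n.
  have h1 := hy (a *: u + v) n; have h2 := hy u n; have h3 := hy v n.
  have a0 := Re_norm_ge0 a.
  have := rnorm_triangle (sqrt_iter n (a *: u + v)) (y (a *: u + v)) (a *: y u + y v).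
  rewrite (rnormBC _ (sqrt_iter _ _)) {2}sqrt_iter_linear opprD addrACA -scalerBr => h4.
  have := rnormD (a *: (sqrt_iter n u - y u)) (sqrt_iter n v - y v); rewrite rnormZc => h5.
  have h6 := ler_wpM2l a0 h2.
  by lra.
have ynorm u : rnorm (y u) <= rnorm u.
  apply/ler_addgt0Pr => e e0.
  have u0 := rnorm_ge0 u; have u1 : 0 < rnorm u + 1 by lra.
  have [n hn] := sqrt_scalar_cvg (divr_gt0 e0 u1).
  have /andP[t0 t1] := sqrt_scalar_bounds n.
  have h1 : (1 - sqrt_scalar n) * rnorm u <= e.
    apply: (@le_trans _ _ (e / (rnorm u + 1) * (rnorm u + 1))).
      by apply: ler_pM => //; lra.
    by rewrite divfK // gt_eqF.
  have := rnormD (y u - sqrt_iter n u) (sqrt_iter n u); rewrite subrK rnormBC.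
  have := hy u n; have := sqrt_iter_norm n u.
  have : sqrt_scalar n * rnorm u <= 1 * rnorm u by rewrite ler_wpM2r.
  by lra.
have yy n u : rnorm (sqrt_iter n (sqrt_iter n u) - y (y u)) <=
    2 * rnorm u * (1 - sqrt_scalar n).
  have := rnorm_triangle (sqrt_iter n (y u)) (sqrt_iter n (sqrt_iter n u)) (y (y u)).
  rewrite -(linB (sqrt_iter_linear n)).
  have := sqrt_iter_norm n (sqrt_iter n u - y u); have := hy (y u) n; have := hy u n.
  have /andP[t0 t1] := sqrt_scalar_bounds n.
  have : sqrt_scalar n * rnorm (sqrt_iter n u - y u) <= 1 * rnorm (sqrt_iter n u - y u).
    by rewrite ler_wpM2r // rnorm_ge0.
  have : (1 - sqrt_scalar n) * rnorm (y u) <= (1 - sqrt_scalar n) * rnorm u.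
    by rewrite ler_wpM2l // subr_ge0.
  by lra.
exists y; split=> //.
- move=> u v; apply/eqP; rewrite -subr_eq0; apply/eqP.
  have bnd u' v' : rip (y u') v' - rip u' (y v') <= 0.
    apply/ler_addgt0Pr => e e0.
    have c1 : 0 < 2 * (rnorm u' * rnorm v') + 1.
      by rewrite ltr_wpDl // mulr_ge0 // mulr_ge0 // rnorm_ge0.
    have [n hn] := sqrt_scalar_cvg (divr_gt0 e0 c1).
    have h1 := hy u' n; have h2 := hy v' n.
    have -> : rip (y u') v' - rip u' (y v') =
       rip (y u' - sqrt_iter n u') v' + rip u' (sqrt_iter n v' - y v').
      by rewrite !(ripDl, ripDr, ripNl, ripNr) sqrt_iter_self; ring.
    have := rip_le hip (y u' - sqrt_iter n u') v'.
    have := rip_le hip u' (sqrt_iter n v' - y v').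
    rewrite (rnormBC (y u')) => h3 h4.
    have h5 := ler_wpM2r (rnorm_ge0 v') h1.
    have h6 := ler_wpM2l (rnorm_ge0 u') h2.
    have h7 : (1 - sqrt_scalar n) * (2 * (rnorm u' * rnorm v') + 1) <= e.
      by rewrite -ler_pdivlMr.
    have /andP[t0 t1] := sqrt_scalar_bounds n.
    by lra.
  apply: le_anti; rewrite bnd /= -oppr_le0 opprB.
  by rewrite (ripC _ (y u)) (ripC _ u) bnd.
- move=> u; apply: (@eq_of_sqrt_rate _ _ (4 * rnorm u)) => n.
  have h1 := yy n u; have h2 := hy u n.+1; have /andP[t0 t1] := sqrt_scalar_bounds n.
  have e : x u + sqrt_iter n (sqrt_iter n u) = sqrt_iter n.+1 u + sqrt_iter n.+1 u.
    rewrite /= -scalerDl -rmorphD /=.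
    by have -> : 2^-1 + 2^-1 = 1 :> R; [lra | rewrite scale1r].
  have -> : y u + y u - (x u + y (y u)) = (y u - sqrt_iter n.+1 u)
     + (y u - sqrt_iter n.+1 u) + (sqrt_iter n (sqrt_iter n u) - y (y u)).
    move: e; move: (sqrt_iter n (sqrt_iter n u)) (sqrt_iter n.+1 u) => q s e.
    rewrite (addrACA (y u) (- s)) -(opprD s) -e opprD (opprD _ q) -!addrA.
    by rewrite (addrA (- q)) addNr add0r.
  have := rnormD (y u - sqrt_iter n.+1 u + (y u - sqrt_iter n.+1 u))
    (sqrt_iter n (sqrt_iter n u) - y (y u)).
  have := rnormD (y u - sqrt_iter n.+1 u) (y u - sqrt_iter n.+1 u).
  rewrite (rnormBC (y u)).
  have : (1 - sqrt_scalar n.+1) * rnorm u <= (1 - sqrt_scalar n) * rnorm u.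
    by rewrite ler_wpM2r ?rnorm_ge0 // lerB // sqrt_scalar_incr.
  by lra.
- move=> z bz hz u; have [K [K0 hK]] := bounded_rnorm bz.
  apply: (@eq_of_sqrt_rate _ _ (rnorm (z u) + K * rnorm u)) => n.
  have := rnorm_triangle (sqrt_iter n (z u)) (y (z u)) (z (y u)).
  rewrite {2}(sqrt_iter_comm n u bz.1 hz) -(linB bz.1).
  rewrite (rnormBC _ (sqrt_iter _ _)).
  have := hK (sqrt_iter n u - y u); have := hy (z u) n.
  have := ler_wpM2l (ltW K0) (hy u n).
  by lra.
Qed.
End SquareRoot.

(** * Sign decomposition of self-adjoint operators *)

Section SignDecomposition.
Local Open Scope complex_scope.
Context {R : realType} {H : completeNormedModType R[i]}.
Variable ip : {dot H for Num.Def.conjC}.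
Hypothesis hip : inner_product_norm ip.
Local Notation rip := (re_inner ip).

(** The conclusion [rnorm (u - s u) <= rnorm u] has the form of the hypothesis
    on [h], so that roots can be taken repeatedly. *)
Lemma contraction_sqrt (h : H -> H) : linear h ->
  (forall u v, rip (h u) v = rip u (h v)) ->
  (forall u, rnorm (u - h u) <= rnorm u) -> exists s : H -> H,
  [/\ linear s, forall u v, rip (s u) v = rip u (s v),
      forall u, rnorm (u - s u) <= rnorm u,
      forall u, s (s u) = h u &
      forall z, bounded_operator z -> (forall u, h (z u) = z (h u)) ->
        forall u, s (z u) = z (s u)].
Proof.
move=> lh hself hc.
have lx : linear (fun u => u - h u).
  by move=> a u v; rewrite lh scalerBr opprD addrACA.
have [|y [ly yself yn yE yz]] := sqrt_iter_limit hip lx _ hc.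
  by move=> u v; rewrite ripDl ripDr ripNl ripNr hself.
exists (fun u => u - y u); split.
- by move=> a u v; rewrite ly scalerBr opprD addrACA.
- by move=> u v; rewrite ripDl ripDr ripNl ripNr yself.
- by move=> u; rewrite opprB addrC subrK.
- move=> u; rewrite (linB ly); have := yE u.
  move: (h u) (y (y u)) => k yy e.
  have -> : u - y u - (y u - yy) = u - (y u + y u) + yy.
    by rewrite opprB !opprD !addrA [RHS]addrAC -!addrA (addrC yy).
  by rewrite e opprD opprB addrA subrK addrCA subrr addr0.
- move=> z bz hz u; rewrite (linB bz.1); congr (_ - _); apply: yz => // v.
  by rewrite (linB bz.1) hz.
Qed.

Lemma bounded_vanish (V : set H) (T : H -> H) w : bounded_operator T ->
  (forall v, V v -> T v = 0) -> adherent V w -> T w = 0.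
Proof.
move=> bT TV hw; have [K [K0 hK]] := bounded_rnorm bT.
apply: rnorm_le_eq0 => e e0; have [|v Vv hv] := hw (e / K); first by rewrite divr_gt0.
have -> : T w = T (w - v) by rewrite (linB bT.1) (TV v) // subr0.
by apply: le_trans (hK _) _; rewrite mulrC -ler_pdivlMr.
Qed.

(** For [c] of norm at most 1 let [m = sqrt (c^2)] be its absolute value, [e] the
    projection onto the kernel of [m - c] and [s = sqrt m]. Since
    [(m + c) (m - c) = 0], the operator [c] equals [m] on the range of [e] and
    [- m] on its complement. *)
Lemma sign_decomposition (c : H -> H) : bounded_operator c -> adjoint_of ip c c ->
  exists e s : H -> H,
  [/\ bounded_operator e /\ bounded_operator s,
      adjoint_of ip e e /\ adjoint_of ip s s,
      forall u, e (e u) = e u,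
      forall u, c u = e (s (s u)) + e (s (s u)) - s (s u) &
      forall z, bounded_operator z -> (forall u, c (z u) = z (c u)) ->
        forall u, e (z u) = z (e u) /\ s (z u) = z (s u)].
Proof.
move=> bc cc; have lc := bc.1; have [K [K0 hK]] := bounded_rnorm bc.
have K1 : K * K^-1 = 1 by rewrite mulfV // gt_eqF.
have cself u v : rip (c u) v = rip u (c v) by rewrite /re_inner cc.
pose c' u := K^-1%:C *: c u.
have lc' : linear c'.
  by move=> a u v; rewrite /c' lc scalerDr !scalerA [a * _]mulrC.
have c'self u v : rip (c' u) v = rip u (c' v) by rewrite ripZl ripZr cself.
have c'n u : rnorm (c' u) <= rnorm u.
  rewrite rnormZ gtr0_norm ?invr_gt0 // mulrC.
  by rewrite ler_pdivrMr // mulrC.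
have bc' : bounded_operator c'.
  by apply: (@rnorm_bounded _ _ _ 1) => // u; rewrite mul1r.
have lh : linear (fun u => c' (c' u)) by move=> a u v; rewrite !lc'.
have hn u : rnorm (u - c' (c' u)) <= rnorm u.
  rewrite -ler_sqr ?nnegrE ?rnorm_ge0 //.
  have : rnorm (c' (c' u)) ^+ 2 <= rnorm (c' u) ^+ 2.
    by rewrite ler_sqr ?nnegrE ?rnorm_ge0.
  rewrite !(rnorm2 hip) !(ripDl, ripDr, ripNl, ripNr) -(c'self u) (c'self (c' u) u).
  have := rip_ge0 hip (c' u); lra.
(* [m] is the absolute value of [c'], and [q] the projection onto the closed
   range of [m - c'], that is [1 - e]. *)
have [m [lm mself mn mE mz]] :=
  contraction_sqrt lh (fun u v => etrans (c'self _ _) (c'self _ _)) hn.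
have [s [ls sself sn sE sz]] := contraction_sqrt lm mself mn.
have bnd (f : H -> H) : linear f -> (forall u, rnorm (u - f u) <= rnorm u) -> bounded_operator f.
  move=> lf hf; apply: (@rnorm_bounded _ _ _ 2) => // u.
  have := hf u; rewrite rnormBC => h; have := rnormD (f u - u) u; rewrite subrK; lra.
have bm := bnd _ lm mn; have bs := bnd _ ls sn.
have mc u : m (c' u) = c' (m u) by apply: mz.
pose V := [set m u - c' u | u in [set: H]].
have sV : subspace V.
  split; first by exists 0 => //; rewrite (lin0 lm) (lin0 lc') subrr.
  move=> a _ _ [u _ <-] [v _ <-]; exists (a *: u + v) => //.
  by rewrite lm lc' scalerBr opprD addrACA.
have orthP w : orth ip V w <-> m w = c' w.
  split=> [hw|e v [u _ <-]].
    apply/eqP; rewrite -subr_eq0; apply/eqP; apply: (@rip_eq0 _ _ ip hip).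
    set t := m w - c' w; rewrite {1}/t ripDl ripNl mself c'self -ripNr -ripDr.
    by apply: hw; exists t.
  by rewrite ripDr ripNr -mself -c'self e subrr.
have [q hq] := projection_exists hip sV; have [bq qself qa qo] := hq.
have zV z : bounded_operator z -> (forall u, c (z u) = z (c u)) ->
    forall u, q (z u) = z (q u) /\ s (z u) = z (s u).
  move=> bz zc u.
  have zc' v : c' (z v) = z (c' v) by rewrite /c' zc (linZ bz.1).
  have zm v : m (z v) = z (m v) by apply: mz => // t; rewrite !zc'.
  split; last exact: sz.
  apply: (projection_comm hip u sV hq bz).
    by move=> _ [v _ <-]; exists (z v) => //; rewrite (linB bz.1) zm zc'.
  by move=> v /orthP e; apply/orthP; rewrite zm zc' e.
have qm u : q (m u) = m (q u).
  apply: (zV m bm _ u).1 => v.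
  have cE t : c t = K%:C *: c' t.
    by rewrite /c' scalerA -rmorphM K1 scale1r.
  by rewrite !cE (linZ lm) mc.
have mq u : c' (q u) = - m (q u).
  apply/eqP; rewrite -addr_eq0; apply/eqP; rewrite addrC.
  apply: (@bounded_vanish V (fun t => m t + c' t)) => //.
    have [A [A0 hA]] := bounded_rnorm bm.
    apply: (@rnorm_bounded _ _ _ (A + 1)).
      by move=> a t v; rewrite lm lc' scalerDr addrACA.
    by move=> t; have := rnormD (m t) (c' t); have := hA t; have := c'n t; lra.
  move=> _ [t _ <-]; rewrite (linB lm) (linB lc') mE mc.
  by rewrite subrKA subrr.
have K2 : 0 <= Num.sqrt K by exact: sqrtr_ge0.
exists (fun u => u - q u), (fun u => (Num.sqrt K)%:C *: s u).
have ls' : linear (fun u => (Num.sqrt K)%:C *: s u).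
  by move=> a u v; rewrite ls scalerDr !scalerA [a * _]mulrC.
have le' : linear (fun u => u - q u).
  by move=> a u v; rewrite bq.1 scalerBr opprD addrACA.
have s'E u : (Num.sqrt K)%:C *: s ((Num.sqrt K)%:C *: s u) = K%:C *: m u.
  by rewrite (linZ ls) sE scalerA -rmorphM -expr2 sqr_sqrtr // ltW.
split.
- split.
    have [A [A0 hA]] := bounded_rnorm bq.
    apply: (@rnorm_bounded _ _ _ (A + 1)) => // t.
    by have := rnormD t (- q t); rewrite rnormN; have := hA t; lra.
  have [A [A0 hA]] := bounded_rnorm bs.
  apply: (@rnorm_bounded _ _ _ (Num.sqrt K * A)) => // t.
  by rewrite rnormZ ger0_norm // -mulrA ler_wpM2l.
- split; apply: adjoint_of_rip => // u v.
    by rewrite ripDl ripDr ripNl ripNr /re_inner qself.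
  by rewrite ripZl ripZr sself.
- move=> u; rewrite (linB bq.1) (projection_id hip sV hq (qa u)).
  by rewrite subrr subr0.
- move=> u; rewrite s'E.
  have -> : c u = K%:C *: c' u by rewrite /c' scalerA -rmorphM K1 scale1r.
  have -> : c' u = m u - q (m u) + (m u - q (m u)) - m u.
    have /orthP := qo u; rewrite (linB lm) (linB lc') mq opprK -qm => e.
    by rewrite {1}e -(addrA (c' u)) (addrC (q (m u)) (m u - _)) subrK addrK.
  by rewrite !scalerBr scalerDr (linZ bq.1) !scalerBr.
- move=> z bz hz u; have [h1 h2] := zV z bz hz u.
  by rewrite h1 h2 (linB bz.1) (linZ bz.1).
Qed.
End SignDecomposition.

(** * Approximate eigenvalues *)

Section ApproximateEigenvalue.
Local Open Scope complex_scope.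
Context {R : realType} {H : completeNormedModType R[i]}.
Variable ip : {dot H for Num.Def.conjC}.
Hypothesis hip : inner_product_norm ip.
Local Notation rip := (re_inner ip).

(** Expand [0 <= <T v, v>] at [v = u - K^-1 T u]. *)
Lemma positive_on_subspace (F : set H) (T : H -> H) (K : R) u : subspace F ->
  linear T -> (forall v, F v -> F (T v)) ->
  (forall v w, rip (T v) w = rip v (T w)) ->
  0 < K -> (forall v, rnorm (T v) <= K * rnorm v) ->
  (forall v, F v -> 0 <= rip (T v) v) -> F u ->
  rnorm (T u) ^+ 2 <= K * rip (T u) u.
Proof.
move=> sF lT TF Tself K0 hK Tpos Fu.
have Fv : F (u - K^-1%:C *: T u).
  apply: (subspaceB sF Fu); rewrite -[_ *: _]addr0; apply: sF.2; last exact: sF.1.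
  exact: TF.
have := Tpos _ Fv; rewrite (linB lT) (linZ lT).
rewrite !(ripDl, ripDr, ripNl, ripNr, ripZl, ripZr) (Tself (T u) u).
have e : rip (T (T u)) (T u) <= K * rip (T u) (T u).
  rewrite -(rnorm2 hip) expr2 mulrA; apply: le_trans (rip_le hip _ _) _.
  by rewrite ler_wpM2r ?rnorm_ge0.
rewrite (rnorm2 hip).
have k0 : 0 < K^-1 by rewrite invr_gt0.
have kK : K^-1 * K = 1 by rewrite mulVf // gt_eqF.
move=> h1.
have h2 : K^-1 * (K^-1 * rip (T (T u)) (T u)) <= K^-1 * rip (T u) (T u).
  rewrite ler_pM2l //; apply: le_trans (_ : K^-1 * (K * rip (T u) (T u)) <= _).
    by rewrite ler_pM2l.
  by rewrite mulrA kK mul1r.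
have h3 : K^-1 * rip (T u) (T u) <= rip (T u) u by move: h1 h2; lra.
have := ler_wpM2l (ltW K0) h3.
by rewrite mulVKf ?gt_eqF.
Qed.

(** The supremum [l] of the quadratic form of [a] over unit vectors of [F] is
    approached by unit vectors at which the positive operator [l - a] has small
    form, hence small norm. *)
Lemma approximate_eigenvalue (F : set H) (a : H -> H) (u0 : H) : subspace F ->
  bounded_operator a -> (forall v, F v -> F (a v)) ->
  (forall v w, rip (a v) w = rip v (a w)) -> F u0 -> u0 <> 0 ->
  exists l : R, forall k : R, 0 < k -> exists u,
    [/\ F u, 0 < rnorm u & rnorm (a u - l%:C *: u) <= k * rnorm u].
Proof.
move=> sF ba aF aself Fu0 u0n.
have [K [K0 hK]] := bounded_rnorm ba.
have FZ t v : F v -> F (t *: v).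
  by move=> Fv; rewrite -[_ *: _]addr0; apply: sF.2 => //; exact: sF.1.
pose E := [set rip (a u) u | u in [set u | F u /\ rnorm u = 1]].
have unit v : F v -> v <> 0 -> F ((rnorm v)^-1%:C *: v) /\ rnorm ((rnorm v)^-1%:C *: v) = 1.
  move=> Fv v0; split; first exact: FZ.
  have n0 : rnorm v != 0 by apply/eqP => /rnorm_eq0.
  by rewrite rnormZ ger0_norm ?invr_ge0 ?rnorm_ge0 // mulVf.
have hE : has_sup E.
  split; first by exists (rip (a ((rnorm u0)^-1%:C *: u0)) ((rnorm u0)^-1%:C *: u0));
    exists ((rnorm u0)^-1%:C *: u0) => //; exact: unit.
  exists K => _ [v [_ v1] <-]; apply: le_trans (rip_le hip _ _) _.
  by rewrite v1 mulr1 (le_trans (hK v)) // v1 mulr1.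
exists (sup E) => k k0; set l := sup E.
pose T u := l%:C *: u - a u.
have lT : linear T.
  move=> b u v; rewrite /T ba.1 scalerDr !scalerBr !scalerA [b * _]mulrC.
  by rewrite opprD addrACA.
have Tself v w : rip (T v) w = rip v (T w).
  by rewrite /T !(ripDl, ripDr, ripNl, ripNr, ripZl, ripZr) aself.
have TF v : F v -> F (T v).
  by move=> Fv; apply: (subspaceB sF); [exact: FZ | exact: aF].
have Tpos v : F v -> 0 <= rip (T v) v.
  move=> Fv; have [->|v0] := pselect (v = 0); first by rewrite rip0r.
  have [Fw w1] := unit v Fv v0; set r := rnorm v in Fw w1.
  have r0 : 0 < r by rewrite lt_def rnorm_ge0 andbT; apply/eqP => /rnorm_eq0.
  have hl : rip (a (r^-1%:C *: v)) (r^-1%:C *: v) <= l.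
    by apply: ub_le_sup; [case: hE | exists (r^-1%:C *: v)].
  rewrite (linZ ba.1) ripZl ripZr mulrA -invfM in hl.
  rewrite /T ripDl ripNl ripZl -(rnorm2 hip) -/r subr_ge0.
  by rewrite -ler_pdivrMr ?exprn_gt0 // mulrC expr2.
have L0 : 0 < `|l| + K by rewrite ltr_wpDl.
have TK v : rnorm (T v) <= (`|l| + K) * rnorm v.
  have := rnormD (l%:C *: v) (- a v); rewrite rnormN rnormZ; have := hK v.
  by rewrite mulrDl; lra.
have e0 : 0 < k ^+ 2 / (`|l| + K) by rewrite divr_gt0 // exprn_gt0.
have [_ [u [Fu u1] <-] hu] := sup_adherent e0 hE.
exists u; split; rewrite ?u1 ?ltr01 // mulr1.
have -> : rnorm (a u - l%:C *: u) = rnorm (T u) by rewrite rnormBC.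
have h := positive_on_subspace sF lT TF Tself L0 TK Tpos Fu.
rewrite -ler_sqr ?nnegrE ?rnorm_ge0 ?(ltW k0) //.
apply: le_trans h _; rewrite mulrC -ler_pdivlMr //.
rewrite /T ripDl ripNl ripZl -(rnorm2 hip) u1 expr1n mulr1.
by move: hu; rewrite -/l; lra.
Qed.
End ApproximateEigenvalue.

(** * A von Neumann algebra as a ring *)

Section Commutants.
Local Open Scope complex_scope.
Context {R : realType} {H : completeNormedModType R[i]}.
Implicit Types (N : set (H -> H)) (x y z : H -> H).

Lemma commutantP N x : commutant N x <->
  bounded_operator x /\ forall y, N y -> forall u, x (y u) = y (x u).
Proof.
split=> -[bx h]; split=> // y Ny.
  by move=> u; rewrite -[LHS]/((x \o y) u) (h y Ny).
by apply/funext => u; exact: h.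
Qed.

Lemma commutant_id N : commutant N idfun.
Proof.
by apply/commutantP; split=> //; apply: (@rnorm_bounded _ _ _ 1) => // u; rewrite mul1r.
Qed.

Lemma commutant_comp N x y : commutant N x -> commutant N y -> commutant N (x \o y).
Proof.
move=> /commutantP[bx hx] /commutantP[bY hy]; apply/commutantP; split.
  have [K [K0 hK]] := bounded_rnorm bx; have [L [L0 hL]] := bounded_rnorm bY.
  apply: (@rnorm_bounded _ _ _ (K * L)); first by move=> a u v /=; rewrite bY.1 bx.1.
  by move=> u /=; apply: le_trans (hK _) _; rewrite -mulrA ler_pM2l.
by move=> z Nz u /=; rewrite hy // hx.
Qed.

Lemma commutant_lin N (a : R[i]) x y : (forall z, N z -> linear z) ->
  commutant N x -> commutant N y -> commutant N (a *: x + y).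
Proof.
move=> lN /commutantP[bx hx] /commutantP[bY hy]; apply/commutantP; split.
  have [K [K0 hK]] := bounded_rnorm bx; have [L [L0 hL]] := bounded_rnorm bY.
  apply: (@rnorm_bounded _ _ _ (complex.Re `|a| * K + L)).
    move=> b u v; rewrite !fctE bx.1 bY.1 !scalerDr !scalerA [a * _]mulrC.
    by rewrite addrACA.
  move=> u; rewrite !fctE; apply: le_trans (rnormD _ _) _.
  rewrite rnormZc mulrDl lerD // -mulrA ler_wpM2l // Re_norm_ge0 //.
by move=> z Nz u; rewrite !fctE (lN z Nz) hx // hy.
Qed.
End Commutants.

Section OperatorAlgebra.
Local Open Scope complex_scope.
Context {R : realType} {H : completeNormedModType R[i]}.
Variables (ip : {dot H for Num.Def.conjC}) (M : set (H -> H)).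
Hypothesis hM : von_neumann_algebra ip M.

Let MC : commutant (commutant M) = M. Proof. by rewrite -hM.1. Qed.

Lemma vn_bounded (x : H -> H) : M x -> bounded_operator x.
Proof. by rewrite -MC => /commutantP[]. Qed.

Lemma vn_id : M idfun.
Proof. by rewrite -MC; exact: commutant_id. Qed.

Lemma vn_comp (x y : H -> H) : M x -> M y -> M (x \o y).
Proof. by rewrite -MC; exact: commutant_comp. Qed.

Lemma vn_lin (a : R[i]) (x y : H -> H) : M x -> M y -> M (a *: x + y).
Proof. by rewrite -MC; apply: commutant_lin => z [] []. Qed.

Lemma vn_zero : M 0.
Proof. by have := vn_lin (-1) vn_id vn_id; rewrite scaleN1r addNr. Qed.

Lemma vn_scale (a : R[i]) (x : H -> H) : M x -> M (a *: x).
Proof. by move=> /(vn_lin a)/(_ vn_zero); rewrite addr0. Qed.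

Lemma vn_add (x y : H -> H) : M x -> M y -> M (x + y).
Proof. by move=> Mx My; have := vn_lin 1 Mx My; rewrite scale1r. Qed.

Lemma vn_opp (x : H -> H) : M x -> M (- x).
Proof. by rewrite -scaleN1r; exact: vn_scale. Qed.

End OperatorAlgebra.

(** The argument [hM] makes the ring structure, whose operations stay inside
    [M] because of the bicommutant property, inferable from the type. *)
Definition vnalg (R : realType) (H : completeNormedModType R[i])
  (ip : {dot H for Num.Def.conjC}) (M : set (H -> H))
  (hM : von_neumann_algebra ip M) : Type := {x : H -> H | M x}.

Section VnAlgStructure.
Local Open Scope complex_scope.
Context {R : realType} {H : completeNormedModType R[i]}.
Context {ip : {dot H for Num.Def.conjC}} {M : set (H -> H)}.
Variable hM : von_neumann_algebra ip M.
Local Notation A := (vnalg hM).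

HB.instance Definition _ := gen_eqMixin A.
HB.instance Definition _ := gen_choiceMixin A.

Definition op (x : A) : H -> H := sval x.

Lemma opM (x : A) : M (op x). Proof. exact: svalP. Qed.

Definition mkop (x : H -> H) (Mx : M x) : A := exist _ x Mx.

Lemma op_ext (x y : A) : (forall u, op x u = op y u) -> x = y.
Proof.
case: x y => [x Mx] [y My] /= h.
have e : x = y by apply/funext.
by case: _ / e My => My; rewrite (Prop_irrelevance Mx My).
Qed.

Lemma op_lin (x : A) : linear (op x).
Proof. by have [] := vn_bounded hM (opM x). Qed.

Let zero : A := mkop (vn_zero hM).
Let add (x y : A) : A := mkop (vn_add hM (opM x) (opM y)).
Let opp (x : A) : A := mkop (vn_opp hM (opM x)).
Let one : A := mkop (vn_id hM).
Let mul (x y : A) : A := mkop (vn_comp hM (opM x) (opM y)).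
Let scale (a : R[i]) (x : A) : A := mkop (vn_scale hM a (opM x)).

Let addA : associative add.
Proof. by move=> x y z; apply: op_ext => u /=; rewrite /op /= addrA. Qed.
Let addC : commutative add.
Proof. by move=> x y; apply: op_ext => u /=; rewrite /op /= addrC. Qed.
Let add0 : left_id zero add.
Proof. by move=> x; apply: op_ext => u; rewrite /op /= add0r. Qed.
Let addN : left_inverse zero opp add.
Proof. by move=> x; apply: op_ext => u; rewrite /op /= addNr. Qed.

HB.instance Definition _ := GRing.isZmodule.Build A addA addC add0 addN.

Let mulA : associative mul.
Proof. by move=> x y z; apply: op_ext. Qed.
Let mul1 : left_id one mul.
Proof. by move=> x; apply: op_ext. Qed.
Let mulr1 : right_id one mul.
Proof. by move=> x; apply: op_ext. Qed.
Let mulDl : left_distributive mul add.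
Proof. by move=> x y z; apply: op_ext. Qed.
Let mulDr : right_distributive mul add.
Proof. by move=> x y z; apply: op_ext => u; exact: linD (op_lin x) _ _. Qed.

HB.instance Definition _ :=
  GRing.Zmodule_isPzRing.Build A mulA mul1 mulr1 mulDl mulDr.

Let scaleA a b (x : A) : scale a (scale b x) = scale (a * b) x.
Proof. by apply: op_ext => u; rewrite /op /= scalerA. Qed.
Let scale1 : left_id 1 scale.
Proof. by move=> x; apply: op_ext => u; rewrite /op /= scale1r. Qed.
Let scaleDr : right_distributive scale +%R.
Proof. by move=> a x y; apply: op_ext => u; rewrite /op /= scalerDr. Qed.
Let scaleDl (x : A) : {morph scale^~ x : a b / a + b}.
Proof. by move=> a b; apply: op_ext => u; rewrite /op /= scalerDl. Qed.

HB.instance Definition _ :=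
  GRing.Zmodule_isLmodule.Build R[i] A scaleA scale1 scaleDr scaleDl.

Lemma opD (x y : A) u : op (x + y) u = op x u + op y u. Proof. by []. Qed.
Lemma opN (x : A) u : op (- x) u = - op x u. Proof. by []. Qed.
Lemma opZ a (x : A) u : op (a *: x) u = a *: op x u. Proof. by []. Qed.
Lemma op0 u : op (0 : A) u = 0. Proof. by []. Qed.
Lemma op_mul (x y : A) u : op (x * y) u = op x (op y u). Proof. by []. Qed.
Lemma op1 u : op (1 : A) u = u. Proof. by []. Qed.
End VnAlgStructure.

(** * Involution, signs and linear derivations *)

Section VnAlgStar.
Local Open Scope complex_scope.
Context {R : realType} {H : completeNormedModType R[i]}.
Context {ip : {dot H for Num.Def.conjC}} {M : set (H -> H)}.
Hypothesis hip : inner_product_norm ip.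
Variable hM : von_neumann_algebra ip M.
Local Notation A := (vnalg hM).
Local Notation rip := (re_inner ip).

Lemma star_exists (x : A) : exists y : A, adjoint_of ip (op x) (op y).
Proof. by have [y My h] := hM.2 _ (opM x); exists (mkop hM My). Qed.

Definition star (x : A) : A := projT1 (cid (star_exists x)).

Lemma starP (x : A) : adjoint_of ip (op x) (op (star x)).
Proof. exact: projT2 (cid (star_exists x)). Qed.

Lemma rip_star (x : A) u v : rip (op x u) v = rip u (op (star x) v).
Proof. by rewrite /re_inner starP. Qed.

Lemma star_unique (x y : A) : (forall u v, rip (op x u) v = rip u (op y v)) ->
  star x = y.
Proof.
move=> h; apply: op_ext => u; apply: (@rip_inj _ _ ip hip) => v.
by rewrite ripC -rip_star h ripC.
Qed.

Lemma star_self (x : A) : adjoint_of ip (op x) (op x) -> star x = x.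
Proof. by move=> h; apply: star_unique => u v; rewrite /re_inner h. Qed.

Lemma starK (x : A) : star (star x) = x.
Proof. by apply: star_unique => u v; rewrite ripC -rip_star ripC. Qed.

Lemma starM (x y : A) : star (x * y) = star y * star x.
Proof. by apply: star_unique => u v; rewrite !op_mul !rip_star. Qed.

Lemma starD (x y : A) : star (x + y) = star x + star y.
Proof. by apply: star_unique => u v; rewrite !opD ripDl ripDr !rip_star. Qed.

Lemma starN (x : A) : star (- x) = - star x.
Proof. by apply: star_unique => u v; rewrite !opN ripNl ripNr !rip_star. Qed.

Lemma starZ a (x : A) : star (a *: x) = a^*%C *: star x.
Proof.
apply: star_unique => u v; rewrite !opZ ripZ_conj rip_star.
by rewrite (linZ (op_lin (star x))).
Qed.

Lemma star_proper (x : A) : star x * x = 0 -> x = 0.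
Proof.
move=> e; apply: op_ext => u; apply: (@rip_eq0 _ _ ip hip).
by rewrite rip_star -op_mul e rip0r.
Qed.

Lemma mulZl a (x y : A) : (a *: x) * y = a *: (x * y).
Proof. exact: op_ext. Qed.

Lemma mulZr a (x y : A) : x * (a *: y) = a *: (x * y).
Proof. by apply: op_ext => u; rewrite op_mul !opZ (linZ (op_lin x)). Qed.

Lemma op_bounded (x : A) : exists K : R, 0 < K /\ forall u, rnorm (op x u) <= K * rnorm u.
Proof. exact: bounded_rnorm (vn_bounded hM (opM x)). Qed.

Lemma vn_commutant_commutant (x : H -> H) : bounded_operator x ->
  (forall z, bounded_operator z -> (forall y, M y -> forall u, z (y u) = y (z u)) ->
     forall u, x (z u) = z (x u)) -> M x.
Proof.
move=> bx h; rewrite hM.1; apply/commutantP; split=> // z /commutantP[bz hz] u.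
exact: h.
Qed.

(** The factors of [sign_decomposition] commute with the commutant of [M], and
    so belong to its bicommutant. *)
Lemma vn_sign (c : A) : star c = c -> exists e s : A,
  [/\ star e = e, e * e = e, star s = s, c = e * (s * s) + e * (s * s) - s * s &
      forall z : A, c * z = z * c -> e * z = z * e /\ s * z = z * s].
Proof.
move=> sc; have bc := vn_bounded hM (opM c).
have cc : adjoint_of ip (op c) (op c) by rewrite -{2}sc; exact: starP.
have [e [s [[be bs] [ae as_] ee cE comm]]] := sign_decomposition hip bc cc.
have Me : M e.
  apply: vn_commutant_commutant => // z bz hz u.
  by apply: (comm z bz _ u).1 => v; rewrite hz //; exact: opM.
have Ms : M s.
  apply: vn_commutant_commutant => // z bz hz u.
  by apply: (comm z bz _ u).2 => v; rewrite hz //; exact: opM.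
exists (mkop hM Me), (mkop hM Ms); split.
- exact: star_self.
- by apply: op_ext => u; rewrite op_mul; exact: ee.
- exact: star_self.
- by apply: op_ext => u; rewrite opD opN opD !op_mul; exact: cE.
- move=> z cz.
  have h u := comm (op z) (vn_bounded hM (opM z)) (fun u => congr1 (fun w : A => op w u) cz) u.
  by split; apply: op_ext => u; rewrite !op_mul; [exact: (h u).1 | exact: (h u).2].
Qed.

Definition linear_derivation (D : A -> A) : Prop :=
  [/\ forall x y, D (x + y) = D x + D y, forall a x, D (a *: x) = a *: D x &
      forall x y, D (x * y) = D x * y + x * D y].

(** * Derivations vanish on commutative corners *)

Section Corner.
Variables (D : A -> A) (p : A).
Hypothesis hD : linear_derivation D.
Hypotheses (pp : p * p = p) (sp : star p = p).
Hypothesis cornerC : forall x y, p * x * p * (p * y * p) = p * y * p * (p * x * p).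

Let pDp (x : A) := p * D x * p.
Definition in_corner (x : A) := p * x = x /\ x * p = x.

Let corner_comm u v : in_corner u -> in_corner v -> u * v = v * u.
Proof.
by move=> [pu up] [pv vp]; have := cornerC u v; rewrite pu up pv vp.
Qed.

Let corner_mul u v : in_corner u -> in_corner v -> in_corner (u * v).
Proof. by move=> [pu up] [pv vp]; split; rewrite ?mulrA ?pu // -mulrA vp. Qed.

Let corner_sub u v : in_corner u -> in_corner v -> in_corner (u - v).
Proof. by move=> [pu up] [pv vp]; split; rewrite ?mulrBr ?mulrBl ?pu ?pv ?up ?vp. Qed.

Let corner_add u v : in_corner u -> in_corner v -> in_corner (u + v).
Proof. by move=> [pu up] [pv vp]; split; rewrite ?mulrDr ?mulrDl ?pu ?pv ?up ?vp. Qed.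

Let corner_scale a u : in_corner u -> in_corner (a *: u).
Proof. by move=> [pu up]; split; rewrite ?mulZr ?mulZl ?pu ?up. Qed.

Let corner_p : in_corner p. Proof. by split. Qed.

Let corner_pDp x : in_corner (pDp x).
Proof. by split; rewrite /pDp ?mulrA ?pp // -mulrA pp. Qed.

Let pDp_add x y : pDp (x + y) = pDp x + pDp y.
Proof. by rewrite /pDp; case: hD => -> _ _; rewrite mulrDr mulrDl. Qed.

Let pDp_scale a x : pDp (a *: x) = a *: pDp x.
Proof. by rewrite /pDp; case: hD => _ -> _; rewrite mulZr mulZl. Qed.

Let pDp_sub x y : pDp (x - y) = pDp x - pDp y.
Proof. by rewrite pDp_add -scaleN1r pDp_scale scaleN1r. Qed.

Let pDp_mul x y : in_corner x -> in_corner y -> pDp (x * y) = pDp x * y + x * pDp y.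
Proof.
move=> [px xp] [py yp]; rewrite /pDp; case: hD => _ _ ->.
rewrite mulrDr mulrDl; congr (_ + _).
  by rewrite -!mulrA yp py.
by rewrite !mulrA px xp.
Qed.

(** In a commutative algebra [d(e) = 2 e d(e)]; multiplication by [e] gives
    [e d(e) = 0]. *)
Let pDp_idem e : in_corner e -> e * e = e -> pDp e = 0.
Proof.
move=> ce ee; have := pDp_mul ce ce; rewrite ee (corner_comm (corner_pDp e) ce) => h.
have h1 : e * pDp e = 0.
  have := congr1 (fun x => e * x) h; rewrite mulrDr !mulrA ee.
  by move=> /esym/(canRL (addrK _)); rewrite subrr.
by rewrite h h1 addr0.
Qed.

(** Cutting the factors of [c = (2 e - 1) s^2] down to the corner, the
    derivation kills [2 e - p] and maps [s^2] to [2 d(s) s], which makes the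
    image of [c] a multiple of [s]. *)
Lemma corner_sign c : in_corner c -> star c = c -> exists e s g : A,
  [/\ in_corner e /\ in_corner s, star e = e /\ star s = s, e * e = e,
      c = e * (s * s) + e * (s * s) - s * s &
      in_corner g /\ pDp c = g * s /\ s * s = (e + e - p) * c].
Proof.
move=> cc sc; have [e [s [se ee ss cE comm]]] := vn_sign sc.
have [ep sp'] : e * p = p * e /\ s * p = p * s.
  by apply: comm; case: cc => -> ->.
have ce : in_corner (p * e) by split; rewrite ?mulrA ?pp // -mulrA ep mulrA pp.
have cs : in_corner (p * s) by split; rewrite ?mulrA ?pp // -mulrA sp' mulrA pp.
have ee' : (p * e) * (p * e) = p * e by rewrite mulrA (ce.2) -mulrA ee.
have ss' : (p * s) * (p * s) = p * (s * s) by rewrite mulrA (cs.2) -mulrA.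
have cE' : c = (p * e) * ((p * s) * (p * s)) + (p * e) * ((p * s) * (p * s)) - (p * s) * (p * s).
  have -> : (p * e) * ((p * s) * (p * s)) = p * (e * (s * s)).
    by rewrite ss' !mulrA ce.2.
  by rewrite ss' -mulrDr -mulrBr -cE cc.1.
have se' : star (p * e) = p * e by rewrite starM se sp.
have sss : star (p * s) = p * s by rewrite starM ss sp.
clear ep sp' ss' comm cE se ee ss.
move: (p * e) (p * s) ce cs ee' cE' se' sss => {}e {}s {}ce {}cs {}ee {}cE {}se {}ss.
set j := e + e - p.
have cj : in_corner j by apply: corner_sub => //; exact: corner_add.
have jj : j * j = p.
  have -> : j * j = (e * e + e * e) + (e * e + e * e) - (e * p + e * p)
      - (p * e + p * e) + p * p by rewrite /j; non_commutative_ring.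
  by rewrite ee ce.1 ce.2 pp addrK subrr add0r.
have cE2 : c = j * (s * s) by rewrite /j mulrBl mulrDl (corner_mul cs cs).1.
exists e, s, (j * (pDp s + pDp s)); split=> //; split.
  by apply: corner_mul => //; apply: corner_add; exact: corner_pDp.
split; last by rewrite {1}cE2 mulrA jj (corner_mul cs cs).1.
have dj : pDp j = 0 by rewrite /j pDp_sub pDp_add !pDp_idem // !addr0 subr0.
rewrite cE2 (pDp_mul cj (corner_mul cs cs)) dj mul0r add0r (pDp_mul cs cs).
rewrite (corner_comm cs (corner_pDp s)).
by rewrite -mulrA -mulrDl.
Qed.

(** The image of [c] is [g * s], and [|s u|^2 = <s^2 u, u>] where [s^2] is
    [c] up to a bounded factor. *)
Lemma corner_growth c : in_corner c -> star c = c -> exists L : R,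
  0 < L /\ forall u, rnorm (op (pDp c) u) ^+ 2 <= L * (rnorm (op c u) * rnorm u).
Proof.
move=> cc sc; have [e [s [g [_ [_ ss] _ _ [_ [dE sE]]]]]] := corner_sign cc sc.
have [K [K0 hK]] := op_bounded g; have [L [L0 hL]] := op_bounded (e + e - p).
exists (K ^+ 2 * L); split; first by rewrite mulr_gt0 ?exprn_gt0.
move=> u; rewrite dE op_mul.
have h1 : rnorm (op g (op s u)) ^+ 2 <= (K * rnorm (op s u)) ^+ 2.
  by rewrite ler_sqr ?nnegrE ?rnorm_ge0 ?mulr_ge0 ?rnorm_ge0 ?(ltW K0).
apply: le_trans h1 _; rewrite exprMn -mulrA ler_pM2l ?exprn_gt0 //.
rewrite (rnorm2 hip) rip_star ss ripC -op_mul sE op_mul.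
apply: le_trans (rip_le hip _ _) _; rewrite mulrA ler_wpM2r ?rnorm_ge0 //.
Qed.

(** Suppose that [b = pDp c] is nonzero. For small [eta] the projection [e]
    onto the part where [star b * b] is at least [eta] is nonzero, and [b] is
    bounded below on its range; [corner_growth] for the translates [c - l] then bounds [c - l] below
    there, contrary to the existence of an approximate eigenvalue of [c]. *)
Lemma corner_derivation_self c : in_corner c -> star c = c -> pDp c = 0.
Proof.
move=> cc sc.
set b := pDp c; set B := star b * b.
have cb : in_corner b by exact: corner_pDp.
have cB : in_corner B.
  have [pb bp] := cb; split; first by rewrite /B mulrA -{1}sp -starM bp.
  by rewrite /B -mulrA bp.
have sB : star B = B by rewrite /B starM starK.
have ripB u : rip (op B u) u = rnorm (op b u) ^+ 2.
  by rewrite (rnorm2 hip) [RHS]rip_star ripC.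
pose shift (l : R) (x : A) := x - l%:C *: p.
have cshift l x : in_corner x -> in_corner (shift l x).
  by move=> cx; apply: corner_sub => //; exact: corner_scale.
have sshift l x : star x = x -> star (shift l x) = shift l x.
  by move=> sx; rewrite /shift starD starN starZ sx sp conjc_real.
have [//|b0] := pselect (b = 0); exfalso.
have [eta [e [eta0 ce ee e0 elow]]] : exists (eta : R) (e : A),
    [/\ 0 < eta, in_corner e, e * e = e, e <> 0 &
        forall u, op e u = u -> eta * rnorm u ^+ 2 <= rnorm (op b u) ^+ 2].
  apply: contrapT => hn; apply: b0; apply: op_ext => u; rewrite op0.
  apply: rnorm_le_eq0 => t t0.
  have [Kp [Kp0 hKp]] := op_bounded p.
  have c0 : 0 < Kp ^+ 2 * rnorm u ^+ 2 + 1 by rewrite ltr_wpDl // mulr_ge0 ?sqr_ge0.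
  (* If [e = 0] for this [eta], then [star b * b <= eta * p], so [rnorm (op b u) <= t]. *)
  set eta := t ^+ 2 / (Kp ^+ 2 * rnorm u ^+ 2 + 1).
  have eta0 : 0 < eta by rewrite divr_gt0 ?exprn_gt0.
  have [e [s [g [[ce cs] [se ss] ee cE _]]]] :=
    corner_sign (cshift eta B cB) (sshift eta B sB).
  have ripp v : rip (op p v) v = rnorm (op p v) ^+ 2.
    by rewrite -{1}pp op_mul rip_star sp (rnorm2 hip).
  have rips v : rip (op (s * s) v) v = rnorm (op s v) ^+ 2.
    by rewrite op_mul rip_star ss (rnorm2 hip).
  have bE v : rnorm (op b v) ^+ 2 = eta * rnorm (op p v) ^+ 2
      + rip (op (e * (s * s) + e * (s * s) - s * s) v) v.
    by rewrite -cE /shift opD opN opZ ripDl ripNl ripZl ripB ripp addrC subrK.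
  have [e0|e0] := pselect (e = 0).
    have := bE u; rewrite e0 mul0r addr0 add0r opN ripNl rips => h.
    rewrite -ler_sqr ?nnegrE ?rnorm_ge0 ?(ltW t0) //.
    have h1 : rnorm (op p u) ^+ 2 <= Kp ^+ 2 * rnorm u ^+ 2.
      by rewrite -exprMn ler_sqr ?nnegrE ?rnorm_ge0 ?mulr_ge0 ?rnorm_ge0 ?(ltW Kp0).
    have h2 : eta * (Kp ^+ 2 * rnorm u ^+ 2 + 1) = t ^+ 2 by rewrite divfK // gt_eqF.
    have h3 : eta * rnorm (op p u) ^+ 2 <= eta * (Kp ^+ 2 * rnorm u ^+ 2).
      by rewrite ler_pM2l.
    have := sqr_ge0 (rnorm (op s u)); rewrite h; lra.
  exfalso; apply: hn; exists eta, e; split=> // v ev.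
  have pv : op p v = v by rewrite -ev -op_mul ce.1.
  have ssv : op (e * (s * s)) v = op (s * s) v.
    by rewrite (corner_comm ce (corner_mul cs cs)) op_mul ev.
  rewrite bE pv opD opN opD ssv addrK rips.
  by rewrite lerDl sqr_ge0.
have [u0 u0n] : exists u0, op e u0 <> 0.
  apply: contrapT => hn; apply: e0; apply: op_ext => u; rewrite op0.
  by apply: contrapT => h; apply: hn; exists u.
pose F := [set u | op e u = u].
have sF : subspace F.
  split; first exact: lin0 (op_lin e).
  by move=> a u v hu hv; rewrite /F /= (op_lin e) hu hv.
have cF v : F v -> F (op c v).
  by move=> Fv; rewrite /F /= -op_mul (corner_comm ce cc) op_mul Fv.
have cself v w : rip (op c v) w = rip v (op c w) by rewrite rip_star sc.
have Fu0 : F (op e u0) by rewrite /F /= -op_mul ee.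
have [l hl] := approximate_eigenvalue hip sF (vn_bounded hM (opM c)) cF cself Fu0 u0n.
have [L [L0 hL]] := corner_growth (cshift l c cc) (sshift l c sc).
(* With this precision, [corner_growth] gives half of the lower bound [elow]. *)
have [|u [Fu u1 hu]] := hl (eta / (2 * L)); first by rewrite divr_gt0 ?mulr_gt0.
have := elow u Fu; have := hL u.
have -> : pDp (shift l c) = b by rewrite pDp_sub pDp_scale (pDp_idem corner_p pp) scaler0 subr0.
have pu : op p u = u by rewrite -Fu -op_mul ce.1.
rewrite opD opN opZ pu => h1 h2.
have h3 : L * (rnorm (op c u - l%:C *: u) * rnorm u) <= L * (eta / (2 * L) * rnorm u * rnorm u).
  by rewrite ler_pM2l // ler_wpM2r // ltW.
have h4 : L * (eta / (2 * L) * rnorm u * rnorm u) = eta * rnorm u ^+ 2 / 2.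
  by field; rewrite gt_eqF.
have : 0 < eta * rnorm u ^+ 2 by rewrite mulr_gt0 // exprn_gt0.
lra.
Qed.

Lemma corner_derivation_zero x : p * D (p * x * p) * p = 0.
Proof.
rewrite -/(pDp _); set y := p * x * p.
have cy : in_corner y by rewrite /y; split; rewrite ?mulrA ?pp // -mulrA pp.
have csy : in_corner (star y).
  by case: cy => py yp; split; rewrite -{1}sp -starM ?py ?yp.
have h1 : pDp (y + star y) = 0.
  by apply: corner_derivation_self; rewrite ?starD ?starK 1?addrC //; exact: corner_add.
have h2 : pDp ('i%C *: (y - star y)) = 0.
  apply: corner_derivation_self; first exact/corner_scale/corner_sub.
  rewrite starZ starD starN starK -[y - _]opprB scalerN -scaleNr.
  by congr (_ *: _); apply/eqP; rewrite eq_complex /= oppr0 !eqxx.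
have h3 : pDp (y - star y) = 0.
  have := congr1 (fun z => (- 'i%C) *: z) h2.
  rewrite pDp_scale scalerA scaler0 => e; rewrite -[LHS]scale1r -[RHS]e; congr (_ *: _).
  by rewrite mulNr -expr2 sqr_i opprK.
have h4 : pDp (y + y) = 0.
  have -> : y + y = (y + star y) + (y - star y).
    by rewrite [RHS]addrACA subrr addr0.
  by rewrite pDp_add h1 h3 addr0.
have : (2 : R[i]) *: pDp y = 0 by rewrite scaler_nat mulr2n -pDp_add.
move=> e; have := congr1 (fun z => (2^-1 : R[i]) *: z) e.
by rewrite scalerA mulVf ?pnatr_eq0 // scale1r scaler0.
Qed.
End Corner.

(** * Abelian projections separate points in type I *)

Definition abelian_elt (p : A) : Prop := abelian_projection ip M (op p).

Lemma abelian_eltP p : abelian_elt p -> [/\ p * p = p, star p = p &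
  forall x y, p * x * p * (p * y * p) = p * y * p * (p * x * p)].
Proof.
move=> [[_ pp sp] pC]; split.
- by apply: op_ext => u; rewrite op_mul; have := congr1 (fun f : H -> H => f u) pp.
- exact: star_self.
- move=> x y; apply: op_ext => u.
  by have := congr1 (fun f : H -> H => f u) (pC _ _ (opM x) (opM y)).
Qed.

Inductive span (S : set H) : H -> Prop :=
| span0 : span S 0
| spanD a u v : S u -> span S v -> span S (a *: u + v).

Lemma subspace_span (S : set H) : subspace (span S).
Proof.
split=> [|a u v hu hv]; first exact: span0.
elim: hu => [|b u' v' Su' _ IH]; first by rewrite scaler0 add0r.
by rewrite scalerDr scalerA -addrA; apply: spanD.
Qed.

Lemma span_map (S : set H) (x : H -> H) : linear x -> (forall u, S u -> S (x u)) ->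
  forall u, span S u -> span S (x u).
Proof.
move=> lx hx u; elim=> [|a u' v' Su' _ IH]; first by rewrite lin0 //; exact: span0.
by rewrite lx; apply: spanD => //; exact: hx.
Qed.

(** The closed span of the vectors [v (p xi)], with [p] abelian, and its
    orthogonal complement are invariant under [M] and under its commutant, so
    the projection [z] onto the complement is central. An abelian projection
    below [z] would map into the span and into its complement; in type I this
    forces [z = 0]. The range of [w] lies in the complement. *)
Lemma abelian_faithful (hI : type_I ip M) (w : A) :
  (forall p : A, abelian_elt p -> forall v : A, p * v * w = 0) -> w = 0.
Proof.
move=> hw.
pose S := [set u | exists (p v : A) xi, abelian_elt p /\ u = op v (op p xi)].
pose L := span S; have sL : subspace L by exact: subspace_span.
have orthL xi : orth ip L xi <-> forall p v : A, abelian_elt p -> op p (op v xi) = 0.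
  split=> [h p v hp|h u].
    have [_ sp _] := abelian_eltP hp.
    apply: (@rip_eq0 _ _ ip hip); rewrite rip_star sp rip_star; apply: h.
    have Su : S (op (star v) (op p (op p (op v xi)))).
      by exists p, (star v), (op p (op v xi)).
    by have := spanD 1 Su (span0 S); rewrite scale1r addr0.
  elim=> [|a _ v' [p [v [t [hp ->]]]] _ IH]; first exact: rip0r.
  have [_ sp _] := abelian_eltP hp.
  rewrite ripDr IH addr0 -(linZ (op_lin v)) -(linZ (op_lin p)).
  by rewrite ripC rip_star rip_star sp (h p _ hp) rip0r.
have [q hq] := projection_exists hip sL; have [bq qself qa qo] := hq.
have qM (x : A) u : q (op x u) = op x (q u).
  apply: (projection_comm hip u sL hq (vn_bounded hM (opM x))).
    apply: span_map; first exact: op_lin.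
    by move=> _ [p [v [t [hp ->]]]]; exists p, (x * v), t.
  by move=> v /orthL h; apply/orthL => p v' hp; rewrite -(op_mul v') h.
have Mq : M q.
  apply: vn_commutant_commutant => // z bz hz u.
  apply: (projection_comm hip u sL hq bz).
    apply: (span_map bz.1) => _ [p [v [t [hp ->]]]]; exists p, v, (z t).
    by rewrite (hz _ (opM v)) (hz _ (opM p)).
  move=> v /orthL h; apply/orthL => p v' hp.
  by rewrite -(hz _ (opM v')) -(hz _ (opM p)) h // (lin0 bz.1).
set z : A := 1 - mkop hM Mq.
have zE u : op z u = u - q u by [].
have z0 : z = 0.
  apply: contrapT => zn.
  have [||p [hp p0 zp]] := hI (op z).
  - split=> [|x Mx]; last first.
      apply/funext => u; rewrite -[LHS]/(op z (x u)) -[RHS]/(x (op z u)) !zE.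
      have lx : linear x := op_lin (mkop hM Mx).
      have qx : q (x u) = x (q u) := qM (mkop hM Mx) u.
      by rewrite (linB lx) qx.
    split; first exact: opM.
      apply/funext => u; rewrite -[LHS]/(op z (op z u)) !zE (linB bq.1).
      by rewrite (projection_id hip sL hq (qa u)) subrr subr0.
    apply: adjoint_of_rip; first exact: op_lin.
    by move=> u v; rewrite !zE ripDl ripDr ripNl ripNr /re_inner qself.
  - move=> e; apply: zn; apply: op_ext => u.
    by have := congr1 (fun f : H -> H => f u) e.
  apply: p0; apply/funext => u.
  have [[Mp pp _] _] := hp.
  have zpu : p u - q (p u) = p u by have := congr1 (fun f : H -> H => f u) zp.
  have := qo (p u); rewrite zpu => /orthL /(_ (mkop hM Mp) 1 hp).
  by rewrite op1 => e; rewrite -[LHS](congr1 (fun f : H -> H => f u) pp).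
apply: op_ext => u; rewrite op0.
have -> : op w u = q (op w u).
  have : op z (op w u) = 0 by rewrite z0.
  by rewrite zE => /eqP; rewrite subr_eq0 => /eqP.
apply: (projection_orth hip sL hq); apply/orthL => p v hp.
by rewrite -[LHS]/(op (p * v * w) u) hw.
Qed.

(** * Passage to the ring of operators *)

Section Transfer.
Implicit Types D : {fun M >-> M}.

Lemma fun_stable D (x : A) : M (D (op x)).
Proof. by have h := @funS _ _ M M D; exact: h (opM x). Qed.

Definition on_alg D (x : A) : A := mkop hM (fun_stable D x).

Lemma on_alg_derivation D : derivation D -> linear_derivation (on_alg D).
Proof.
move=> [Dl Dm].
have DD (a : R[i]) (x y : A) : on_alg D (a *: x + y) = a *: on_alg D x + on_alg D y.
  by apply: op_ext => u; rewrite -[LHS]/(D (a *: op x + op y) u) Dl //; exact: opM.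
have D0 : on_alg D 0 = 0.
  have := DD 1 0 0; rewrite !scale1r addr0 => /esym/(canRL (addrK _)).
  by rewrite subrr.
split=> [x y|a x|x y].
- by have := DD 1 x y; rewrite !scale1r.
- by have := DD a x 0; rewrite D0 !addr0.
- by apply: op_ext => u; rewrite -[LHS]/(D (op x \o op y) u) Dm //; exact: opM.
Qed.

Lemma linear_derivationB (D E : A -> A) :
  linear_derivation D -> linear_derivation E -> linear_derivation (fun x => D x - E x).
Proof.
move=> [Da Dz Dm] [Ea Ez Em]; split=> [x y|a x|x y].
- by rewrite Da Ea opprD addrACA.
- by rewrite Dz Ez scalerBr.
- by rewrite Dm Em mulrBl mulrBr opprD addrACA.
Qed.

Lemma two_local_additive_leibniz (hI : type_I ip M) (T : A -> A) :
  (forall x y : A, exists D : A -> A,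
    [/\ linear_derivation D, T x = D x & T y = D y]) ->
  (forall x y, T (x + y) = T x + T y) /\
  (forall x y, T (x * y) = T x * y + x * T y).
Proof.
move=> loc.
have torsion2 (x : A) : x + x = 0 -> x = 0.
  move=> xx; have e : (2 : R[i]) *: x = 0 by rewrite scaler_nat mulr2n.
  have := congr1 (fun z => (2^-1 : R[i]) *: z) e.
  by rewrite scalerA mulVf ?pnatr_eq0 // scale1r scaler0.
have DerD (D : A -> A) : linear_derivation D ->
  forall x y, D (x + y) = D x + D y by case.
have DerM (D : A -> A) : linear_derivation D ->
  forall x y, D (x * y) = D x * y + x * D y by case.
have idem (p : A) : abelian_elt p -> p * p = p by case/abelian_eltP.
have self (p : A) : abelian_elt p -> star p = p by case/abelian_eltP.
have comm (p : A) : abelian_elt p -> forall x y : A,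
  p * x * p * (p * y * p) = p * y * p * (p * x * p) by case/abelian_eltP.
have corner (D : A -> A) (p : A) : linear_derivation D -> abelian_elt p ->
    forall x : A, p * D (p * x * p) * p = 0.
  move=> hD hp x; apply: corner_derivation_zero => //.
  - exact: idem.
  - exact: self.
  - exact: comm.
split.
  exact: two_local_additive starK starM star_proper DerD DerM
    linear_derivationB idem self comm corner (abelian_faithful hI) loc.
exact: two_local_derivation_leibniz torsion2 starK starM star_proper DerD DerM
  linear_derivationB idem self comm corner (abelian_faithful hI) loc.
Qed.

End Transfer.
End VnAlgStar.

(** Homogeneity comes from 2-locality at [a *: x] and [x]; the rest is the
    preceding lemma read in the ring of operators. *)
Theorem theorem5 (R : realType) (H : completeNormedModType R[i])
    (ip : {dot H for Num.Def.conjC}) (hip : inner_product_norm ip)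
    (M : set (H -> H)) (hM : von_neumann_algebra ip M) (hI : type_I ip M)
    (Delta : {fun M >-> M}) (hDelta : two_local_derivation Delta) :
  derivation Delta.
Proof.
have loc (x y : vnalg hM) : exists D : vnalg hM -> vnalg hM, [/\ linear_derivation D,
    on_alg Delta x = D x & on_alg Delta y = D y].
  have [D [hD ex ey]] := hDelta _ _ (opM x) (opM y).
  exists (on_alg D); split; first exact: on_alg_derivation.
    by apply: op_ext => u; rewrite -[LHS]/(Delta (op x) u) ex.
  by apply: op_ext => u; rewrite -[LHS]/(Delta (op y) u) ey.
have [addD mulD] := two_local_additive_leibniz hip hI loc.
have scaleD a (x : vnalg hM) : on_alg Delta (a *: x) = a *: on_alg Delta x.
  by have [D [hD -> ->]] := loc (a *: x) x; case: hD => _ ->.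
split=> [a x y Mx My|x y Mx My].
  have := addD (a *: mkop hM Mx) (mkop hM My); rewrite scaleD.
  by move/(congr1 (@op _ _ _ _ hM)).
have := mulD (mkop hM Mx) (mkop hM My).
by move/(congr1 (@op _ _ _ _ hM)).
Qed.
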